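(* Let $(A,\Gamma)$ be a Hopf algebroid. Then there is an equivalence of categories between the category of $\Gamma$-comodules and the category of quasi-coherent sheaves over the presheaf of groupoids $(\operatorname{Spec}A,\operatorname{Spec}\Gamma)$.
   Context: All rings are commutative with unit and of cardinality less than some fixed infinite cardinal $\kappa$; $\mathbf{Rings}$ is the category of such rings and $\mathbf{Aff}$ its opposite. For a ring $A$, $\operatorname{Spec}A:\mathbf{Rings}\to\mathbf{Set}$ is the functor $(\operatorname{Spec}A)(R)=\mathbf{Rings}(A,R)$. A presheaf of groupoids on $\mathbf{Aff}$ is a functor $(X_0,X_1)$ from $\mathbf{Rings}$ to small groupoids; $X_0(R)$ is the set of objects and $X_1(R)$ the set of morphisms of the groupoid attached to $R$, with natural maps $\operatorname{dom},\operatorname{codom}:X_1\to X_0$, composition, identities and inverses. Hopf algebroid: a pair $(A,\Gamma)$ of rings with ring maps $\eta_L,\eta_R:A\to\Gamma$ (left and right units), $\epsilon:\Gamma\to A$ (counit), $\Delta:\Gamma\to\Gamma\otimes_A\Gamma$ (diagonal; the left factor is a right $A$-module via $\eta_R$, the right factor a left $A$-module via $\eta_L$) and $c:\Gamma\to\Gamma$ (conjugation, exchanging $\eta_L$ and $\eta_R$) which make $(\operatorname{Spec}A,\operatorname{Spec}\Gamma)$ a presheaf of groupoids. Here $\alpha:\Gamma\to R$ is a morphism from $\alpha\eta_L$ to $\alpha\eta_R$; if $\alpha\eta_R=\beta\eta_L$, then $\beta\circ\alpha$ is the composite $\Gamma\xrightarrow{\Delta}\Gamma\otimes_A\Gamma\xrightarrow{\alpha\otimes\beta}R\otimes_A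 R\xrightarrow{\text{mult}}R$; the identity of $x:A\to R$ is $x\epsilon$. No flatness is assumed. A $\Gamma$-comodule is an $A$-module $M$ with an $A$-linear map $\psi:M\to\Gamma\otimes_A M$ (tensor product formed using $\eta_R$; $A$ acts on the target through $\eta_L$) that is coassociative, $(\Delta\otimes1)\psi=(1\otimes\psi)\psi$, and counital, $(\epsilon\otimes1)\psi=\mathrm{id}_M$. Morphisms are $A$-linear maps commuting with $\psi$. A point of a functor $X:\mathbf{Rings}\to\mathbf{Set}$ is a pair $(R,x)$ with $x\in X(R)$; a map of points $(R,x)\to(S,y)$ is a ring map $f:R\to S$ with $X(f)(x)=y$. A quasi-coherent sheaf $M$ over $X$ is a functorial assignment to each point $(R,x)$ of an $R$-module $M_x$ and to each map of points $f:(R,x)\to(S,y)$ of an $R$-linear map $\theta(f):M_x\to M_y$ (with $\theta(1)=1$, $\theta(gf)=\theta(g)\theta(f)$), such that the adjoint $S\otimes_R M_x\to M_y$ of $\theta(f)$ is an isomorphism for every $f$. A map of such is a family of $R$-linear maps $M_x\to N_x$ natural in $(R,x)$. A quasi-coherent sheaf over $(X_0,X_1)$ is a quasi-coherent sheaf $M$ over $X_0$ with an isomorphism $\psi:\operatorname{dom}^*M\to\operatorname{codom}^*M$ over $X_1$, i.e. $R$-linear isomorphisms $\psi_\alpha:M_{\operatorname{dom}\alpha}\to M_{\operatorname{codom}\alpha}$ natural in the points $(R,\alpha)$ of $X_1$, satisfying the cocycle condition $\psi_{\beta\alpha}=\psi_\beta\psi_\alpha$ for composable $\beta,\alpha$.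 A map $\tau:M\to N$ is a map over $X_0$ with $\tau_{\operatorname{codom}\alpha}\psi^M_\alpha=\psi^N_\alpha\tau_{\operatorname{dom}\alpha}$ for all $\alpha$. *)

(* Defs.v *)
From HB Require Import structures.
From mathcomp Require Import all_boot all_order all_algebra.
From mathcomp Require Import generic_quotient.
From mathcomp Require Import boolp classical_sets functions cardinality.
Set Implicit Arguments.
Unset Strict Implicit.
Unset Printing Implicit Defensive.
Import GRing.Theory.
Local Open Scope ring_scope.
Local Open Scope quotient_scope.

(* Rings are [comPzRingType]s rather than [comNzRingType]s: the zero ring is
   allowed. *)

Section Tensor.
Variables (A B : comPzRingType) (f : {rmorphism A -> B}) (N : lmodType A).

(* B (x)_A N for an A-algebra f : A -> B and an A-module N: formal sums of
   pairs, written as words, modulo the congruence generated by the relations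
   below. Words only form a monoid, hence the generator [tens_eq_0l]; inverses
   are then -(b (x) n) = (-b) (x) n. B acts on the left factor. *)
Inductive tens_eq : seq (B * N) -> seq (B * N) -> Prop :=
| tens_eq_refl w : tens_eq w w
| tens_eq_sym w w' : tens_eq w w' -> tens_eq w' w
| tens_eq_trans w' w w'' : tens_eq w w' -> tens_eq w' w'' -> tens_eq w w''
| tens_eq_cat w1 w1' w2 w2' :
    tens_eq w1 w1' -> tens_eq w2 w2' -> tens_eq (w1 ++ w2) (w1' ++ w2')
| tens_eq_catC w1 w2 : tens_eq (w1 ++ w2) (w2 ++ w1)
| tens_eq_0l n : tens_eq [:: (0, n)] [::]
| tens_eq_Dl b b' n : tens_eq [:: (b + b', n)] [:: (b, n); (b', n)]
| tens_eq_Dr b n n' : tens_eq [:: (b, n + n')] [:: (b, n); (b, n')]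
| tens_eq_bal b a n : tens_eq [:: (b * f a, n)] [:: (b, a *: n)].

Definition tens_eqb : rel (seq (B * N)) := fun w w' => `[< tens_eq w w' >].

Lemma tens_eqb_equiv : equiv_class_of tens_eqb.
Proof.
split=> [w|w w'|w w' w''].
- exact/asboolP/tens_eq_refl.
- by apply/asboolP/asboolP=> /tens_eq_sym.
- by move=> /asboolP h /asboolP h'; apply/asboolP/(tens_eq_trans h h').
Qed.

Canonical tens_equiv := EquivRelPack tens_eqb_equiv.

Definition tens : Type := {eq_quot tens_equiv}.
HB.instance Definition _ := Choice.on tens.
HB.instance Definition _ := EqQuotient.on tens.

Lemma tens_piE w w' : (\pi_tens w = \pi_tens w') <-> tens_eq w w'.
Proof.
split=> [/eqmodP/asboolP //|h].
exact/eqmodP/asboolP.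
Qed.

Lemma tens_repr w : tens_eq (repr (\pi_tens w)) w.
Proof. by apply/tens_piE; rewrite reprK. Qed.

Definition tens_add (t u : tens) : tens := \pi_tens (repr t ++ repr u).
Definition tens_opp (t : tens) : tens :=
  \pi_tens [seq (- p.1, p.2) | p <- repr t].
Definition tens_scale (b : B) (t : tens) : tens :=
  \pi_tens [seq (b * p.1, p.2) | p <- repr t].

Lemma tens_eq_map (g : B -> B) : {morph g : x y / x + y} ->
    (forall b a, g (b * f a) = g b * f a) ->
  forall w w', tens_eq w w' ->
  tens_eq [seq (g p.1, p.2) | p <- w] [seq (g p.1, p.2) | p <- w'].
Proof.
move=> gD gM; have g0 : g 0 = 0.
  by apply: (addrI (g 0)); rewrite -gD !addr0.
move=> w w'; elim=> {w w'} [w|w w' _|w' w w'' _ h _|w1 w1' w2 w2' _ h1 _ h2|||||] /=.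
- exact: tens_eq_refl.
- exact: tens_eq_sym.
- exact: tens_eq_trans.
- by rewrite !map_cat; apply: tens_eq_cat.
- by move=> w1 w2; rewrite !map_cat; apply: tens_eq_catC.
- by move=> n; rewrite g0; apply: tens_eq_0l.
- by move=> b b' n; rewrite gD; apply: tens_eq_Dl.
- by move=> b n n'; apply: tens_eq_Dr.
- by move=> b a n; rewrite gM; apply: tens_eq_bal.
Qed.

Lemma tens_addE w w' : tens_add (\pi w) (\pi w') = \pi_tens (w ++ w').
Proof. by apply/tens_piE/tens_eq_cat; apply: tens_repr. Qed.

Lemma tens_oppE w : tens_opp (\pi w) = \pi_tens [seq (- p.1, p.2) | p <- w].
Proof.
apply/tens_piE/tens_eq_map; last exact: tens_repr.
- exact: opprD.
- by move=> b a; rewrite mulNr.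
Qed.

Lemma tens_scaleE b w :
  tens_scale b (\pi w) = \pi_tens [seq (b * p.1, p.2) | p <- w].
Proof.
apply/tens_piE/tens_eq_map; last exact: tens_repr.
- exact: mulrDr.
- by move=> c a; rewrite mulrA.
Qed.

Lemma tens_addA : associative tens_add.
Proof.
move=> t u v; rewrite -[t]reprK -[u]reprK -[v]reprK !tens_addE.
by rewrite catA.
Qed.

Lemma tens_addC : commutative tens_add.
Proof.
move=> t u; rewrite -[t]reprK -[u]reprK !tens_addE.
exact/tens_piE/tens_eq_catC.
Qed.

Lemma tens_add0 : left_id (\pi_tens [::]) tens_add.
Proof. by move=> t; rewrite -[t]reprK !tens_addE. Qed.

Lemma tens_addN : left_inverse (\pi_tens [::]) tens_opp tens_add.
Proof.
move=> t; rewrite -[t]reprK tens_oppE.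
elim: (repr t) => [|[b n] w IH] /=; first by rewrite tens_addE.
set w' := [seq _ | _ <- w] in IH *.
have consE p v : \pi_tens (p :: v) = tens_add (\pi [:: p]) (\pi v).
  by rewrite tens_addE.
rewrite (consE _ w) (consE _ w') -tens_addA [X in tens_add _ X]tens_addC -tens_addA.
rewrite [X in tens_add _ (tens_add _ X)]tens_addC IH.
rewrite [X in tens_add _ X]tens_addC tens_add0 tens_addE.
apply/tens_piE; apply: tens_eq_trans (tens_eq_0l n).
by rewrite -(addNr b); apply/tens_eq_sym/tens_eq_Dl.
Qed.

HB.instance Definition _ :=
  GRing.isZmodule.Build tens tens_addA tens_addC tens_add0 tens_addN.

Lemma tpiD w w' : \pi_tens w + \pi_tens w' = \pi_tens (w ++ w').
Proof. exact: tens_addE. Qed.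

Definition tpure (b : B) (n : N) : tens := \pi [:: (b, n)].

Lemma tpi_sum w : \pi_tens w = \sum_(p <- w) tpure p.1 p.2.
Proof.
elim: w => [|[b n] w IH]; first by rewrite big_nil.
by rewrite big_cons -IH -cat1s -tens_addE.
Qed.

Lemma tpure_sum t : t = \sum_(p <- repr t) tpure p.1 p.2.
Proof. by rewrite -tpi_sum reprK. Qed.

Lemma tpureDl b b' n : tpure (b + b') n = tpure b n + tpure b' n.
Proof. by rewrite [RHS]tens_addE; apply/tens_piE/tens_eq_Dl. Qed.

Lemma tpureDr b n n' : tpure b (n + n') = tpure b n + tpure b n'.
Proof. by rewrite [RHS]tens_addE; apply/tens_piE/tens_eq_Dr. Qed.

Lemma tpure_bal b a n : tpure (b * f a) n = tpure b (a *: n).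
Proof. exact/tens_piE/tens_eq_bal. Qed.

Lemma tens_scale_pi b w :
  tens_scale b (\pi w) = \sum_(p <- w) tpure (b * p.1) p.2.
Proof. by rewrite tens_scaleE tpi_sum big_map. Qed.

Lemma tens_scaleA b b' t :
  tens_scale b (tens_scale b' t) = tens_scale (b * b') t.
Proof.
rewrite -[t]reprK !tens_scaleE -map_comp; congr (\pi _).
by apply: eq_map => p /=; rewrite mulrA.
Qed.

Lemma tens_scale1 : left_id 1 tens_scale.
Proof.
move=> t; rewrite -[t in LHS]reprK tens_scale_pi [RHS]tpure_sum.
by apply: eq_bigr => p _; rewrite mul1r.
Qed.

Lemma tens_scaleDr : right_distributive tens_scale +%R.
Proof.
move=> b t u; rewrite -[t]reprK -[u]reprK tpiD !tens_scale_pi.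
by rewrite big_cat.
Qed.

Lemma tens_scaleDl t : {morph tens_scale^~ t : b b' / b + b'}.
Proof.
move=> b b' /=; rewrite -[t]reprK !tens_scale_pi -big_split /=.
by apply: eq_bigr => p _; rewrite mulrDl tpureDl.
Qed.

HB.instance Definition _ := GRing.Zmodule_isLmodule.Build B tens
  tens_scaleA tens_scale1 tens_scaleDr tens_scaleDl.

Lemma tpureZ b b' n : b *: tpure b' n = tpure (b * b') n.
Proof. by rewrite [LHS]tens_scaleE. Qed.

Lemma tens_ind (P : tens -> Prop) :
    P 0 -> (forall b n, P (tpure b n)) -> (forall t u, P t -> P u -> P (t + u)) ->
  forall t, P t.
Proof. by move=> P0 Pp PD t; rewrite (tpure_sum t); elim/big_ind: _. Qed.

Definition balanced (P : zmodType) (F : B -> N -> P) :=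
  [/\ forall n, {morph F^~ n : b b' / b + b'},
      forall b, {morph F b : n n' / n + n'}
    & forall b a n, F (b * f a) n = F b (a *: n)].

(* The map b (x) n |-> F b n; it is computed on the canonical representative
   and has its meaning ([tlift_pure], [tliftD]) when F is balanced. *)
Definition tlift (P : zmodType) (F : B -> N -> P) (t : tens) : P :=
  \sum_(p <- repr t) F p.1 p.2.

Section Lift.
Variables (P : zmodType) (F : B -> N -> P).
Hypothesis Fbal : balanced F.

Lemma tens_eq_lift w w' : tens_eq w w' ->
  \sum_(p <- w) F p.1 p.2 = \sum_(p <- w') F p.1 p.2.
Proof.
have [FDl FDr Fb] := Fbal; elim=> {w w'} [||||||||] //.
- by move=> w' w w'' _ -> _ ->.
- by move=> w1 w1' w2 w2' _ h1 _ h2; rewrite !big_cat /= h1 h2.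
- by move=> w1 w2; rewrite !big_cat /= addrC.
- move=> n; rewrite big_seq1 big_nil /=.
  by apply: (addrI (F 0 n)); rewrite -FDl !addr0.
- by move=> b b' n; rewrite big_seq1 big_cons big_seq1 /= FDl.
- by move=> b b' n; rewrite big_seq1 big_cons big_seq1 /= FDr.
- by move=> b a n; rewrite !big_seq1 /= Fb.
Qed.

Lemma tlift_pure b n : tlift F (tpure b n) = F b n.
Proof. by rewrite /tlift (tens_eq_lift (tens_repr _)) big_seq1. Qed.

Lemma tliftD : {morph tlift F : t u / t + u}.
Proof.
move=> t u; rewrite -[t]reprK -[u]reprK tpiD /tlift.
by rewrite !(tens_eq_lift (tens_repr _)) big_cat.
Qed.

Lemma tlift0 : tlift F 0 = 0.
Proof. by rewrite /tlift (tens_eq_lift (tens_repr _)) big_nil. Qed.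

End Lift.
End Tensor.

(* V seen as an A-module through g : A -> B. *)
Definition restr (A B : comPzRingType) (g : {rmorphism A -> B})
  (V : lmodType B) : Type := V.

Section Restriction.
Variables (A B : comPzRingType) (g : {rmorphism A -> B}) (V : lmodType B).

Local Notation restr := (restr g V).

HB.instance Definition _ := GRing.Zmodule.on restr.

Definition restr_scale (a : A) (v : restr) : restr := g a *: (v : V).

Lemma restr_scaleA a b v :
  restr_scale a (restr_scale b v) = restr_scale (a * b) v.
Proof. by rewrite /restr_scale scalerA rmorphM. Qed.

Lemma restr_scale1 : left_id 1 restr_scale.
Proof. by move=> v; rewrite /restr_scale rmorph1 scale1r. Qed.

Lemma restr_scaleDr : right_distributive restr_scale +%R.
Proof. by move=> a u v; apply: scalerDr. Qed.

Lemma restr_scaleDl v : {morph restr_scale^~ v : a b / a + b}.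
Proof. by move=> a b; rewrite /restr_scale rmorphD scalerDl. Qed.

HB.instance Definition _ := GRing.Zmodule_isLmodule.Build A restr
  restr_scaleA restr_scale1 restr_scaleDr restr_scaleDl.

Lemma restr_scaleE (a : A) (v : restr) : a *: v = g a *: (v : V) :> V.
Proof. by []. Qed.

End Restriction.

Section TensorRing.
Variables (A B C : comPzRingType).
Variables (f : {rmorphism A -> B}) (g : {rmorphism A -> C}).

(* The ring B (x)_A C; B is a (right) A-module through f, C a (left) A-module
   through g. *)
Definition rtens : Type := tens f (restr g C^o).
HB.instance Definition _ := GRing.Lmodule.on rtens.

Definition rpure (b : B) (c : C) : rtens := tpure f b (c : restr g C^o).

Definition rbalanced (P : zmodType) (F : B -> C -> P) :=
  @balanced _ _ f (restr g C^o) P F.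

Definition rlift (P : zmodType) (F : B -> C -> P) (t : rtens) : P :=
  @tlift _ _ f (restr g C^o) P F t.

Lemma rlift_pure (P : zmodType) (F : B -> C -> P) b c :
  rbalanced F -> rlift F (rpure b c) = F b c.
Proof. by move=> FB; apply: (tlift_pure FB). Qed.

Lemma rliftD (P : zmodType) (F : B -> C -> P) :
  rbalanced F -> {morph rlift F : t u / t + u}.
Proof. by move=> FB t u; apply: (tliftD FB). Qed.

Lemma rlift0 (P : zmodType) (F : B -> C -> P) : rbalanced F -> rlift F 0 = 0.
Proof. by move=> FB; apply: (tlift0 FB). Qed.

Definition rtens_mul (t u : rtens) : rtens :=
  rlift (fun b c => rlift (fun b' c' => rpure (b * b') (c * c')) u) t.

Lemma rpureDl b b' c : rpure (b + b') c = rpure b c + rpure b' c.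
Proof. exact: tpureDl. Qed.

Lemma rpureDr b c c' : rpure b (c + c') = rpure b c + rpure b c'.
Proof. exact: tpureDr. Qed.

Lemma rpure_bal b a c : rpure (b * f a) c = rpure b (g a * c).
Proof. exact: tpure_bal. Qed.

Lemma rtens_ind (P : rtens -> Prop) :
    P 0 -> (forall b c, P (rpure b c)) -> (forall t u, P t -> P u -> P (t + u)) ->
  forall t, P t.
Proof. exact: (@tens_ind _ _ f (restr g C^o) P). Qed.

Lemma rtens_mul_bal1 b (c : C) :
  rbalanced (fun b' c' => rpure (b * b') (c * c')).
Proof.
split=> [c'|b'|b' a c'] /=.
- by move=> x y /=; rewrite mulrDr rpureDl.
- by move=> x y /=; rewrite mulrDr rpureDr.
- by rewrite mulrA rpure_bal restr_scaleE /= mulrCA.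
Qed.

Lemma rtens_mul_bal2 (u : rtens) :
  rbalanced
    (fun b c => rlift (fun b' c' => rpure (b * b') (c * c')) u).
Proof.
split=> [c|b|b a c] /=.
- move=> x y /=; rewrite /rlift /tlift -big_split /=; apply: eq_bigr => p _.
  by rewrite mulrDl rpureDl.
- move=> x y /=; rewrite /rlift /tlift -big_split /=; apply: eq_bigr => p _.
  by rewrite mulrDl rpureDr.
- rewrite /rlift /tlift; apply: eq_bigr => p _.
  by rewrite mulrAC rpure_bal restr_scaleE /= mulrA.
Qed.

Lemma rtens_mulE b c b' c' :
  rtens_mul (rpure b c) (rpure b' c') = rpure (b * b') (c * c').
Proof.
rewrite /rtens_mul rlift_pure; last exact: rtens_mul_bal2.
by rewrite rlift_pure //; apply: rtens_mul_bal1.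
Qed.

Lemma rtens_mulDl : left_distributive rtens_mul +%R.
Proof. by move=> t t' u; apply/rliftD/rtens_mul_bal2. Qed.

Lemma rtens_mulDr : right_distributive rtens_mul +%R.
Proof.
move=> t u u'; rewrite /rtens_mul /rlift {1 2 3}/tlift -big_split /=.
by apply: eq_bigr => p _; apply/rliftD/rtens_mul_bal1.
Qed.

Lemma rtens_mul0t u : rtens_mul 0 u = 0.
Proof. exact/rlift0/rtens_mul_bal2. Qed.

Lemma rtens_mult0 t : rtens_mul t 0 = 0.
Proof. by apply: (addrI (rtens_mul t 0)); rewrite -rtens_mulDr !addr0. Qed.

Lemma rtens_mulC : commutative rtens_mul.
Proof.
elim/rtens_ind=> [u|b c|t t' IH IH' u]; last 1 first.
- by rewrite rtens_mulDl IH IH' rtens_mulDr.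
- by rewrite rtens_mul0t rtens_mult0.
elim/rtens_ind=> [|b' c'|u u' IH IH'].
- by rewrite rtens_mul0t rtens_mult0.
- by rewrite !rtens_mulE mulrC [c * _]mulrC.
- by rewrite rtens_mulDr IH IH' -rtens_mulDl.
Qed.

Lemma rtens_mulA : associative rtens_mul.
Proof.
elim/rtens_ind=> [u v|b c|t t' IH IH' u v]; last 1 first.
- by rewrite !rtens_mulDl IH IH'.
- by rewrite !rtens_mul0t.
elim/rtens_ind=> [v|b' c'|t t' IH IH' v]; last 1 first.
- by rewrite !(rtens_mulDl, rtens_mulDr) IH IH'.
- by rewrite !(rtens_mul0t, rtens_mult0).
elim/rtens_ind=> [|b'' c''|t t' IH IH'].
- by rewrite !rtens_mult0.
- by rewrite !rtens_mulE !mulrA.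
- by rewrite !rtens_mulDr IH IH'.
Qed.

Lemma rtens_mul1 : left_id (rpure 1 1) rtens_mul.
Proof.
elim/rtens_ind=> [|b c|t t' IH IH'].
- exact: rtens_mult0.
- by rewrite rtens_mulE !mul1r.
- by rewrite rtens_mulDr IH IH'.
Qed.

HB.instance Definition _ := GRing.Zmodule_isComPzRing.Build rtens
  rtens_mulA rtens_mulC rtens_mul1 rtens_mulDl.

Lemma rpureM b c b' c' : rpure b c * rpure b' c' = rpure (b * b') (c * c').
Proof. exact: rtens_mulE. Qed.

Lemma rpure11 : rpure 1 1 = 1.
Proof. by []. Qed.

Definition rinr (c : C) : rtens := rpure 1 c.

Lemma rinr_zmod : zmod_morphism rinr.
Proof.
move=> c c'; apply: (addIr (rinr c')).
by rewrite subrK -rpureDr subrK.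
Qed.

Lemma rinr_monoid : monoid_morphism rinr.
Proof. by split=> [|c c']; rewrite // rpureM mulr1. Qed.

HB.instance Definition _ := GRing.isZmodMorphism.Build C rtens rinr rinr_zmod.
HB.instance Definition _ :=
  GRing.isMonoidMorphism.Build C rtens rinr rinr_monoid.

Section Pairing.
Variables (R : comPzRingType) (u : {rmorphism B -> R}) (v : {rmorphism C -> R}).

(* The composite B (x)_A C -> R (x)_A R -> R of u (x) v with the
   multiplication of R. *)
Definition rpair (t : rtens) : R := rlift (fun b c => u b * v c) t.

Hypothesis uv : u \o f =1 v \o g.

Lemma rpair_bal :
  rbalanced (fun b c => u b * v c).
Proof.
split=> [c|b|b a c] /=.
- by move=> x y /=; rewrite rmorphD mulrDl.
- by move=> x y /=; rewrite rmorphD mulrDr.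
- by rewrite rmorphM restr_scaleE rmorphM /= mulrA [u (f a)]uv.
Qed.

Lemma rpairE b c : rpair (rpure b c) = u b * v c.
Proof. by apply: rlift_pure; apply: rpair_bal. Qed.

Lemma rpair_zmod : zmod_morphism rpair.
Proof.
move=> s t; apply: (addIr (rpair t)).
by rewrite subrK -(rliftD rpair_bal) subrK.
Qed.

Lemma rpair_monoid : monoid_morphism rpair.
Proof.
split=> [|s t]; first by rewrite -rpure11 rpairE !rmorph1 mulr1.
have rD x y : rpair (x + y) = rpair x + rpair y := rliftD rpair_bal x y.
have r0 : rpair 0 = 0 := rlift0 rpair_bal.
elim/rtens_ind: s => [|b c|s s' IH IH'].
- by rewrite mul0r r0 mul0r.
- elim/rtens_ind: t => [|b' c'|t t' IH IH'].
  + by rewrite mulr0 r0 mulr0.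
  + by rewrite rpureM !rpairE !rmorphM mulrACA.
  + by rewrite mulrDr !rD mulrDr IH IH'.
- by rewrite mulrDl !rD mulrDl IH IH'.
Qed.

Definition rpair_rmorph : {rmorphism rtens -> R} :=
  HB.pack rpair (GRing.isZmodMorphism.Build rtens R rpair rpair_zmod)
    (GRing.isMonoidMorphism.Build rtens R rpair rpair_monoid).

End Pairing.
End TensorRing.

Lemma rmorph_ext (R S : pzRingType) (f g : {rmorphism R -> S}) :
  f =1 g -> f = g.
Proof.
case: f g => [f [[a] [b]]] [g [[a'] [b']]] /= /funext fg.
by subst g; rewrite (Prop_irrelevance a a') (Prop_irrelevance b b').
Qed.

Lemma linear_ext (R : pzRingType) (U : lmodType R) (V : zmodType)
  (s : R -> V -> V) (f g : {linear U -> V | s}) : f =1 g -> f = g.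
Proof.
case: f g => [f [[a] [b]]] [g [[a'] [b']]] /= /funext fg.
by subst g; rewrite (Prop_irrelevance a a') (Prop_irrelevance b b').
Qed.

Section TensorMaps.

(* phi (x) h; meaningful under the hypotheses of [tens_map_pure]. *)
Definition tens_map (A B A' B' : comPzRingType) (f : {rmorphism A -> B})
    (f' : {rmorphism A' -> B'}) (N : lmodType A) (N' : lmodType A')
    (phi : B -> B') (h : N -> N') : tens f N -> tens f' N' :=
  tlift (fun b n => tpure f' (phi b) (h n)).

Section TensorMapTheory.
Variables (A B A' B' : comPzRingType) (f : {rmorphism A -> B}).
Variables (f' : {rmorphism A' -> B'}) (s : {rmorphism A -> A'}).
Variables (N : lmodType A) (N' : lmodType A').
Variables (phi : {rmorphism B -> B'}) (h : N -> N').
Hypothesis sq : phi \o f =1 f' \o s.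
Hypothesis hD : {morph h : m n / m + n}.
Hypothesis hZ : forall a n, h (a *: n) = s a *: h n.

Lemma tens_map_bal : balanced f (fun b n => tpure f' (phi b) (h n)).
Proof.
split=> [n x y|b x y|b a n] /=.
- by rewrite rmorphD tpureDl.
- by rewrite hD tpureDr.
- by rewrite rmorphM [phi (f a)]sq tpure_bal hZ.
Qed.

Lemma tens_map_pure b n : tens_map f' phi h (tpure f b n) = tpure f' (phi b) (h n).
Proof. exact: (tlift_pure tens_map_bal). Qed.

Lemma tens_mapD : {morph (tens_map f' phi h : tens f N -> _) : t u / t + u}.
Proof. exact: (tliftD tens_map_bal). Qed.

Lemma tens_map0 : tens_map f' phi h (0 : tens f N) = 0.
Proof. exact: (tlift0 tens_map_bal). Qed.

End TensorMapTheory.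

(* The canonical map (B (x)_A C) (x)_A N -> B (x)_A (C (x)_A N), where C is an
   A-module on the left through g and on the right through h. *)
Definition tens_assoc (A B C : comPzRingType) (f : {rmorphism A -> B})
    (g h : {rmorphism A -> C}) (N : lmodType A) :
    tens (rinr f g \o h) N -> tens f (restr g (tens h N)) :=
  tlift (fun t n => rlift (fun b c => @tpure _ _ f (restr g (tens h N)) b
                                        (tpure h c n)) t).

Lemma tens_assoc_pure (A B C : comPzRingType) (f : {rmorphism A -> B})
    (g h : {rmorphism A -> C}) (N : lmodType A) (b : B) (c : C) (n : N) :
  tens_assoc (tpure (rinr f g \o h) (rpure f g b c) n) =
  @tpure _ _ f (restr g (tens h N)) b (tpure h c n).
Proof.
have rb n' : rbalanced f g (fun b c => @tpure _ _ f (restr g (tens h N)) b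
                                        (tpure h c n')).
  split=> [c'|b'|b' a c'] /=.
  - by move=> x y; rewrite tpureDl.
  - by move=> x y; rewrite tpureDl tpureDr.
  - rewrite tpure_bal; congr (tpure _ _ _).
    by rewrite [LHS]restr_scaleE tpureZ.
rewrite /tens_assoc tlift_pure ?rlift_pure //.
split=> [n' x y|t x y|t a n'] /=.
- exact: (rliftD (rb n')).
- rewrite /rlift /tlift -big_split /=; apply: eq_bigr => p _.
  by rewrite !tpureDr.
- elim/rtens_ind: t => [|b' c'|t t' IH IH'].
  + by rewrite mul0r !(rlift0 (rb _)).
  + by rewrite /rinr rpureM !rlift_pure //= mulr1 tpure_bal.
  + by rewrite mulrDl !(rliftD (rb _)) IH IH'.
Qed.

End TensorMaps.

Record category := Category {
  obj :> Type;
  hom : obj -> obj -> Type;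
  idc : forall x, hom x x;
  compc : forall x y z, hom y z -> hom x y -> hom x z;
  compc1l : forall x y (f : hom x y), compc (idc y) f = f;
  compc1r : forall x y (f : hom x y), compc f (idc x) = f;
  compcA : forall x y z t (h : hom z t) (g : hom y z) (f : hom x y),
    compc h (compc g f) = compc (compc h g) f
}.

Record functor (C D : category) := Functor {
  fobj :> C -> D;
  fmap : forall x y, hom x y -> hom (fobj x) (fobj y);
  fmap_id : forall x, fmap (idc x) = idc (fobj x);
  fmap_comp : forall x y z (g : hom y z) (f : hom x y),
    fmap (compc g f) = compc (fmap g) (fmap f)
}.

Definition idF (C : category) : functor C C :=
  @Functor C C id (fun _ _ f => f) (fun _ => erefl) (fun _ _ _ _ _ => erefl).

Section FunctorComposition.
Variables (C D E : category) (G : functor D E) (F : functor C D).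

Lemma compF_id x : fmap G (fmap F (idc x)) = idc (G (F x)).
Proof. by rewrite !fmap_id. Qed.

Lemma compF_comp x y z (g : hom y z) (f : hom x y) :
  fmap G (fmap F (compc g f)) = compc (fmap G (fmap F g)) (fmap G (fmap F f)).
Proof. by rewrite !fmap_comp. Qed.

Definition compF : functor C E :=
  @Functor C E (fun x => G (F x)) (fun _ _ f => fmap G (fmap F f))
    compF_id compF_comp.

End FunctorComposition.

Record nattrans (C D : category) (F G : functor C D) := NatTrans {
  ntc :> forall x, hom (F x) (G x);
  nt_natural : forall x y (f : hom x y),
    compc (ntc y) (fmap F f) = compc (fmap G f) (ntc x)
}.

Definition is_iso (C : category) (x y : C) (f : hom x y) : Prop :=
  exists g : hom y x, compc g f = idc x /\ compc f g = idc y.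

Definition isomorphic_functors (C D : category) (F G : functor C D) : Prop :=
  exists t : nattrans F G, forall x, is_iso (t x).

Definition equivalent_categories (C D : category) : Prop :=
  exists (F : functor C D) (G : functor D C),
    isomorphic_functors (idF C) (compF G F) /\
    isomorphic_functors (compF F G) (idF D).

Definition types : category :=
  @Category Type (fun S T => S -> T) (fun _ => id) (fun _ _ _ g f => g \o f)
    (fun _ _ _ => erefl) (fun _ _ _ => erefl) (fun _ _ _ _ _ _ _ => erefl).

(* K stands for the cardinal kappa = |K|. *)
Definition card_below (K T : Type) : Prop :=
  ([set: T] #<= [set: K])%card /\ ~ ([set: K] #<= [set: T])%card.

Record sring (K : Type) := SRing {
  sring_ring :> comPzRingType;
  sring_small : card_below K sring_ring
}.

Section Rings.
Variable K : Type.
Implicit Types R S T U : sring K.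

Definition rings_id R : {rmorphism R -> R} := idfun.
Definition rings_comp R S T (g : {rmorphism S -> T}) (f : {rmorphism R -> S}) :
  {rmorphism R -> T} := g \o f.

Lemma rings_comp1l R S (f : {rmorphism R -> S}) :
  rings_comp (rings_id S) f = f.
Proof. exact: rmorph_ext. Qed.

Lemma rings_comp1r R S (f : {rmorphism R -> S}) :
  rings_comp f (rings_id R) = f.
Proof. exact: rmorph_ext. Qed.

Lemma rings_compA R S T U (h : {rmorphism T -> U}) (g : {rmorphism S -> T})
    (f : {rmorphism R -> S}) :
  rings_comp h (rings_comp g f) = rings_comp (rings_comp h g) f.
Proof. exact: rmorph_ext. Qed.

Definition rings : category :=
  Category rings_comp1l rings_comp1r rings_compA.

End Rings.

Definition presheaf (K : Type) := functor (rings K) types.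

Section Spec.
Variables (K : Type) (A : sring K).

Definition spec_map (R S : sring K) (f : {rmorphism R -> S}) :
  {rmorphism A -> R} -> {rmorphism A -> S} := fun x => rings_comp f x.

Lemma spec_map_id (R : sring K) : @spec_map R R (rings_id R) = id.
Proof. by apply/funext => x; apply: rings_comp1l. Qed.

Lemma spec_map_comp (R S T : sring K) (g : {rmorphism S -> T})
    (f : {rmorphism R -> S}) :
  spec_map (rings_comp g f) = spec_map g \o spec_map f.
Proof. by apply/funext => x /=; rewrite /spec_map rings_compA. Qed.

Definition Spec : presheaf K :=
  @Functor (rings K) types (fun R : sring K => {rmorphism A -> R})
    spec_map spec_map_id spec_map_comp.

End Spec.

Section SpecMap.
Variables (K : Type) (A B : sring K) (u : {rmorphism A -> B}).

Definition spec_pre (R : sring K) : {rmorphism B -> R} -> {rmorphism A -> R} :=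
  fun x => rings_comp x u.

Lemma spec_pre_natural (R S : sring K) (f : {rmorphism R -> S}) :
  @spec_pre S \o spec_map f = spec_map f \o @spec_pre R.
Proof. by apply/funext => x; apply: rmorph_ext. Qed.

Definition SpecMap : nattrans (Spec B) (Spec A) :=
  @NatTrans _ _ (Spec B) (Spec A) spec_pre spec_pre_natural.

End SpecMap.

(* gcomp e is the composite b after a. *)
Record groupoid_data (K : Type) := GroupoidData {
  gob : presheaf K;
  gmor : presheaf K;
  gdom : nattrans gmor gob;
  gcod : nattrans gmor gob;
  gid : nattrans gob gmor;
  ginv : nattrans gmor gmor;
  gcomp : forall (R : sring K) (b a : gmor R), gcod R a = gdom R b -> gmor R
}.

Record is_groupoid (K : Type) (X : groupoid_data K) : Prop := IsGroupoid {
  dom_id : forall (R : sring K) (x : gob X R), gdom X R (gid X R x) = x;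
  cod_id : forall (R : sring K) (x : gob X R), gcod X R (gid X R x) = x;
  dom_inv : forall (R : sring K) (a : gmor X R),
    gdom X R (ginv X R a) = gcod X R a;
  cod_inv : forall (R : sring K) (a : gmor X R),
    gcod X R (ginv X R a) = gdom X R a;
  dom_comp : forall (R : sring K) (b a : gmor X R) (e : gcod X R a = gdom X R b),
    gdom X R (gcomp e) = gdom X R a;
  cod_comp : forall (R : sring K) (b a : gmor X R) (e : gcod X R a = gdom X R b),
    gcod X R (gcomp e) = gcod X R b;
  comp_natural : forall (R S : sring K) (f : {rmorphism R -> S})
      (b a : gmor X R) (e : gcod X R a = gdom X R b)
      (e' : gcod X S (fmap (gmor X) f a) = gdom X S (fmap (gmor X) f b)),
    fmap (gmor X) f (gcomp e) = gcomp e';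
  comp_id_l : forall (R : sring K) (a : gmor X R)
      (e : gcod X R a = gdom X R (gid X R (gcod X R a))), gcomp e = a;
  comp_id_r : forall (R : sring K) (a : gmor X R)
      (e : gcod X R (gid X R (gdom X R a)) = gdom X R a), gcomp e = a;
  comp_assoc : forall (R : sring K) (c b a : gmor X R)
      (e1 : gcod X R a = gdom X R b) (e2 : gcod X R b = gdom X R c)
      (e3 : gcod X R a = gdom X R (gcomp e2))
      (e4 : gcod X R (gcomp e1) = gdom X R c),
    gcomp e3 = gcomp e4;
  comp_inv_l : forall (R : sring K) (a : gmor X R)
      (e : gcod X R a = gdom X R (ginv X R a)),
    gcomp e = gid X R (gdom X R a);
  comp_inv_r : forall (R : sring K) (a : gmor X R)
      (e : gcod X R (ginv X R a) = gdom X R a),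
    gcomp e = gid X R (gcod X R a)
}.

Record groupoid_presheaf (K : Type) := GroupoidPresheaf {
  gp_data :> groupoid_data K;
  gp_groupoid : is_groupoid gp_data
}.

(* hA and hG are A and Gamma. *)
Record hopf_data (K : Type) := HopfData {
  hA : sring K;
  hG : sring K;
  etaL : {rmorphism hA -> hG};
  etaR : {rmorphism hA -> hG};
  epsilon : {rmorphism hG -> hA};
  Delta : {rmorphism hG -> rtens etaR etaL};
  conjugation : {rmorphism hG -> hG}
}.

Section SpecHopf.
Variables (K : Type) (H : hopf_data K).

Lemma spec_composable (R : sring K) (b a : {rmorphism hG H -> R}) :
  SpecMap (etaR H) R a = SpecMap (etaL H) R b -> a \o etaR H =1 b \o etaL H.
Proof. by move=> e x; apply: (congr1 (fun h : {rmorphism hA H -> R} => h x) e). Qed.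

(* b after a is (mult o (a (x) b)) o Delta. *)
Definition spec_comp (R : sring K) (b a : {rmorphism hG H -> R})
    (e : SpecMap (etaR H) R a = SpecMap (etaL H) R b) : {rmorphism hG H -> R} :=
  rpair_rmorph (spec_composable e) \o Delta H.

Definition spec_groupoid_data : groupoid_data K :=
  @GroupoidData K (Spec (hA H)) (Spec (hG H)) (SpecMap (etaL H))
    (SpecMap (etaR H)) (SpecMap (epsilon H)) (SpecMap (conjugation H)) spec_comp.

End SpecHopf.

Record hopf_algebroid (K : Type) := HopfAlgebroid {
  ha_data :> hopf_data K;
  ha_groupoid : is_groupoid (spec_groupoid_data ha_data)
}.

Definition spec_groupoid (K : Type) (H : hopf_algebroid K) :
  groupoid_presheaf K := GroupoidPresheaf (ha_groupoid H).

Section Comodules.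
Variables (K : Type) (H : hopf_data K).

(* Delta (x) 1 goes to (Gamma (x)_A Gamma) (x)_A M, formed with
   x |-> 1 (x) etaR x. It is well defined for a Hopf algebroid, where
   Delta o etaR = (x |-> 1 (x) etaR x) is the codomain law of the universal
   composable pair, and likewise epsilon o etaR = id for epsilon (x) 1. The last
   step of [counital] is the canonical isomorphism A (x)_A M -> M. *)
Record comodule := Comodule {
  cm_mod :> lmodType (hA H);
  coaction : {linear cm_mod -> tens (etaR H) cm_mod | etaL H \; *:%R};
  coassociative : forall m : cm_mod,
    tens_assoc (tens_map (rinr (etaR H) (etaL H) \o etaR H) (Delta H) idfun
                  (coaction m)) =
    tens_map (N' := restr (etaL H) (tens (etaR H) cm_mod)) (etaR H)
      idfun coaction (coaction m);
  counital : forall m : cm_mod,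
    tlift (fun a n => a *: n)
      (tens_map (rings_id (hA H)) (epsilon H) idfun (coaction m)) = m
}.

Record comodule_hom (M N : comodule) := ComoduleHom {
  cm_lin :> {linear M -> N};
  cm_commutes : forall m,
    coaction N (cm_lin m) = tens_map (etaR H) idfun cm_lin (coaction M m)
}.

Lemma comodule_hom_ext (M N : comodule) (s t : comodule_hom M N) :
  s =1 t -> s = t.
Proof.
move=> /linear_ext; case: s t => [s sP] [t tP] /= st; subst t.
by rewrite (Prop_irrelevance sP tP).
Qed.

Lemma comodule_id_subproof (M : comodule) m :
  coaction M (idfun m) = tens_map (etaR H) idfun idfun (coaction M m).
Proof. exact: tpure_sum. Qed.

Definition comodule_id (M : comodule) : comodule_hom M M :=
  @ComoduleHom M M idfun (@comodule_id_subproof M).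

Lemma comodule_comp_subproof (M N P : comodule) (t : comodule_hom N P)
    (s : comodule_hom M N) m :
  coaction P ((t \o s) m) = tens_map (etaR H) idfun (t \o s) (coaction M m).
Proof.
case: t s => [t tP] [s sP] /=; rewrite tP sP.
have sq : idfun \o etaR H =1 etaR H \o idfun by [].
have map0 (U V : comodule) (h : {linear U -> V}) :
  tens_map (etaR H) idfun h (0 : tens (etaR H) U) = 0 := tens_map0 sq (linearD h) (linearZ_LR h).
have mapD (U V : comodule) (h : {linear U -> V}) :
  {morph (tens_map (etaR H) idfun h : tens (etaR H) U -> _) : x y / x + y} := tens_mapD sq (linearD h) (linearZ_LR h).
have mapP (U V : comodule) (h : {linear U -> V}) b n :
  tens_map (etaR H) idfun h (tpure _ b n) = tpure _ b (h n) :=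
  tens_map_pure sq (linearD h) (linearZ_LR h) b n.
elim/tens_ind: (coaction M m) => [|b n|u v IHu IHv].
- by rewrite !(map0 M) map0.
- by rewrite !mapP.
- by rewrite !mapD IHu IHv.
Qed.

Definition comodule_comp (M N P : comodule) (t : comodule_hom N P)
    (s : comodule_hom M N) : comodule_hom M P :=
  @ComoduleHom M P (t \o s) (comodule_comp_subproof t s).

Lemma comodule_comp1l M N (f : comodule_hom M N) :
  comodule_comp (comodule_id N) f = f.
Proof. exact: comodule_hom_ext. Qed.

Lemma comodule_comp1r M N (f : comodule_hom M N) :
  comodule_comp f (comodule_id M) = f.
Proof. exact: comodule_hom_ext. Qed.

Lemma comodule_compA M N P Q (h : comodule_hom P Q) (g : comodule_hom N P)
    (f : comodule_hom M N) :
  comodule_comp h (comodule_comp g f) = comodule_comp (comodule_comp h g) f.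
Proof. exact: comodule_hom_ext. Qed.

Definition comodules : category :=
  Category comodule_comp1l comodule_comp1r comodule_compA.

End Comodules.

Section Points.
Variables (K : Type) (X : presheaf K).

Record point := Point { pt_ring : sring K; pt_elt : X pt_ring }.

Record pt_hom (p q : point) := PtHom {
  pt_map : {rmorphism pt_ring p -> pt_ring q};
  pt_mapP : fmap X pt_map (pt_elt p) = pt_elt q
}.

Lemma pt_hom_ext p q (f g : pt_hom p q) : pt_map f = pt_map g -> f = g.
Proof.
case: f g => [f fP] [g gP] /= fg; subst g.
by rewrite (Prop_irrelevance fP gP).
Qed.

Lemma pt_same_subproof (R : sring K) (x y : X R) :
  x = y -> fmap X (rings_id R) x = y.
Proof. by move=> <-; rewrite (@fmap_id _ _ X R). Qed.

(* Equal elements x and y give the map of points (R, x) -> (R, y) over 1_R; the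
   induced isomorphisms identify M_x with M_y. *)
Definition pt_same (R : sring K) (x y : X R) (e : x = y) :
    pt_hom (Point x) (Point y) :=
  @PtHom (Point x) (Point y) (rings_id R) (pt_same_subproof e).

Definition pt_id (p : point) : pt_hom p p :=
  @PtHom p p (rings_id (pt_ring p)) (pt_same_subproof erefl).

Lemma pt_comp_subproof p q r (g : pt_hom q r) (f : pt_hom p q) :
  fmap X (rings_comp (pt_map g) (pt_map f)) (pt_elt p) = pt_elt r.
Proof.
by rewrite (@fmap_comp _ _ X _ _ _ (pt_map g) (pt_map f)) /= (pt_mapP f) (pt_mapP g).
Qed.

Definition pt_comp p q r (g : pt_hom q r) (f : pt_hom p q) : pt_hom p r :=
  PtHom (pt_comp_subproof g f).

Lemma pt_comp1l p q (f : pt_hom p q) : pt_comp (pt_id q) f = f.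
Proof. exact/pt_hom_ext/rings_comp1l. Qed.

Lemma pt_comp1r p q (f : pt_hom p q) : pt_comp f (pt_id p) = f.
Proof. exact/pt_hom_ext/rings_comp1r. Qed.

Lemma pt_compA p q r s (h : pt_hom r s) (g : pt_hom q r) (f : pt_hom p q) :
  pt_comp h (pt_comp g f) = pt_comp (pt_comp h g) f.
Proof. exact/pt_hom_ext/rings_compA. Qed.

Definition points : category := Category pt_comp1l pt_comp1r pt_compA.

End Points.

Section QuasiCoherent.
Variables (K : Type) (X : presheaf K).

Definition adjoint (R S : comPzRingType) (f : {rmorphism R -> S})
    (M : lmodType R) (N : lmodType S) (t : M -> N) : tens f M -> N :=
  tlift (fun s m => s *: t m).

Record qcoh := QCoh {
  qfib :> forall p : points X, lmodType (pt_ring p);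
  theta : forall (p q : points X) (f : hom p q),
    {linear qfib p -> qfib q | pt_map f \; *:%R};
  theta_id : forall (p : points X) (m : qfib p), theta (idc p) m = m;
  theta_comp : forall (p q r : points X) (g : hom q r) (f : hom p q) (m : qfib p),
    theta (compc g f) m = theta g (theta f m);
  theta_iso : forall (p q : points X) (f : hom p q),
    bijective (@adjoint _ _ (pt_map f) (qfib p) (qfib q) (theta f))
}.

Record qcoh_hom (M N : qcoh) := QCohHom {
  qh_map :> forall p, {linear M p -> N p};
  qh_natural : forall (p q : points X) (f : hom p q) (m : M p),
    qh_map q (theta M f m) = theta N f (qh_map p m)
}.

Lemma qcoh_hom_ext (M N : qcoh) (s t : qcoh_hom M N) :
  (forall p, s p =1 t p) -> s = t.
Proof.
case: s t => [s sP] [t tP] /= st.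
have {}st : s = t.
  by apply: functional_extensionality_dep => p; exact: linear_ext (st p).
by subst t; rewrite (Prop_irrelevance sP tP).
Qed.

Definition qcoh_id (M : qcoh) : qcoh_hom M M :=
  @QCohHom M M (fun p => idfun) (fun _ _ _ _ => erefl).

Lemma qcoh_comp_subproof (M N P : qcoh) (t : qcoh_hom N P) (s : qcoh_hom M N)
    (p q : points X) (f : hom p q) (m : M p) :
  (t q \o s q) (theta M f m) = theta P f ((t p \o s p) m).
Proof. by rewrite /= !qh_natural. Qed.

Definition qcoh_comp (M N P : qcoh) (t : qcoh_hom N P) (s : qcoh_hom M N) :
    qcoh_hom M P :=
  @QCohHom M P (fun p => t p \o s p) (qcoh_comp_subproof t s).

End QuasiCoherent.

Section Pullback.
Variables (K : Type) (X Y : presheaf K) (u : nattrans X Y) (M : qcoh Y).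

Definition pt_push (p : points X) : points Y := Point (u (pt_ring p) (pt_elt p)).

Lemma pt_push_subproof (p q : points X) (f : hom p q) :
  fmap Y (pt_map f) (pt_elt (pt_push p)) = pt_elt (pt_push q).
Proof.
rewrite /= -(pt_mapP f).
exact: esym (congr1 (fun h => h (pt_elt p)) (nt_natural u (pt_map f))).
Qed.

Definition pt_push_hom (p q : points X) (f : hom p q) :
    hom (pt_push p) (pt_push q) :=
  @PtHom _ Y (pt_push p) (pt_push q) (pt_map f) (pt_push_subproof f).

Lemma pullback_id (p : points X) (m : M (pt_push p)) :
  theta M (pt_push_hom (idc p)) m = m.
Proof.
rewrite -[RHS](@theta_id _ _ M); congr (theta M _ m).
exact: pt_hom_ext.
Qed.

Lemma pullback_comp (p q r : points X) (g : hom q r) (f : hom p q)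
    (m : M (pt_push p)) :
  theta M (pt_push_hom (compc g f)) m =
  theta M (pt_push_hom g) (theta M (pt_push_hom f) m).
Proof.
rewrite -theta_comp; congr (theta M _ m).
exact: pt_hom_ext.
Qed.

Definition pullback : qcoh X :=
  @QCoh K X (fun p => M (pt_push p)) (fun p q f => theta M (pt_push_hom f))
    pullback_id pullback_comp (fun p q f => theta_iso M (pt_push_hom f)).

End Pullback.

Section QuasiCoherentGroupoid.
Variables (K : Type) (X : groupoid_presheaf K).

Record gqcoh := GQCoh {
  gq_sheaf :> qcoh (gob X);
  gq_psi : qcoh_hom (pullback (gdom X) gq_sheaf) (pullback (gcod X) gq_sheaf);
  gq_iso : forall p, bijective (gq_psi p);
  gq_cocycle : forall (R : sring K) (b a : gmor X R)
      (e : gcod X R a = gdom X R b) (m : gq_sheaf (Point (gdom X R a))),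
    let psi (c : gmor X R) : gq_sheaf (Point (gdom X R c)) ->
                             gq_sheaf (Point (gcod X R c)) :=
      gq_psi (Point c) in
    theta gq_sheaf (pt_same (cod_comp (gp_groupoid X) e))
      (psi (gcomp e)
        (theta gq_sheaf (pt_same (esym (dom_comp (gp_groupoid X) e))) m)) =
    psi b (theta gq_sheaf (pt_same e) (psi a m))
}.

Record gqcoh_hom (M N : gqcoh) := GQCohHom {
  gqh_hom :> qcoh_hom M N;
  gqh_commutes : forall (R : sring K) (a : gmor X R)
      (m : M (Point (gdom X R a))),
    gqh_hom (Point (gcod X R a)) (gq_psi M (Point a) m) =
    gq_psi N (Point a) (gqh_hom (Point (gdom X R a)) m)
}.

Lemma gqcoh_hom_ext (M N : gqcoh) (s t : gqcoh_hom M N) :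
  (forall p, s p =1 t p) -> s = t.
Proof.
case: s t => [s sP] [t tP] /= /qcoh_hom_ext st; subst t.
by rewrite (Prop_irrelevance sP tP).
Qed.

Definition gqcoh_id (M : gqcoh) : gqcoh_hom M M :=
  @GQCohHom M M (qcoh_id M) (fun _ _ _ => erefl).

Lemma gqcoh_comp_subproof (M N P : gqcoh) (t : gqcoh_hom N P)
    (s : gqcoh_hom M N) (R : sring K) (a : gmor X R)
    (m : M (Point (gdom X R a))) :
  qcoh_comp t s (Point (gcod X R a)) (gq_psi M (Point a) m) =
  gq_psi P (Point a) (qcoh_comp t s (Point (gdom X R a)) m).
Proof. by rewrite /= !gqh_commutes. Qed.

Definition gqcoh_comp (M N P : gqcoh) (t : gqcoh_hom N P) (s : gqcoh_hom M N) :
    gqcoh_hom M P := GQCohHom (gqcoh_comp_subproof t s).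

Lemma gqcoh_comp1l M N (f : gqcoh_hom M N) : gqcoh_comp (gqcoh_id N) f = f.
Proof. exact: gqcoh_hom_ext. Qed.

Lemma gqcoh_comp1r M N (f : gqcoh_hom M N) : gqcoh_comp f (gqcoh_id M) = f.
Proof. exact: gqcoh_hom_ext. Qed.

Lemma gqcoh_compA M N P Q (h : gqcoh_hom P Q) (g : gqcoh_hom N P)
    (f : gqcoh_hom M N) :
  gqcoh_comp h (gqcoh_comp g f) = gqcoh_comp (gqcoh_comp h g) f.
Proof. exact: gqcoh_hom_ext. Qed.

Definition quasi_coherent_sheaves : category :=
  Category gqcoh_comp1l gqcoh_comp1r gqcoh_compA.

End QuasiCoherentGroupoid.

(* Main.v *)
Require Import Defs.
From HB Require Import structures.
From mathcomp Require Import all_boot all_order all_algebra.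
From mathcomp Require Import boolp classical_sets functions cardinality.
Set Implicit Arguments.
Unset Strict Implicit.
Unset Printing Implicit Defensive.
(* [Defs] is imported again because mathcomp shadows its [hom] and [point]. *)
Import Defs GRing.Theory.

(* A comodule M gives the sheaf (R, x) |-> R (x)_{A,x} M, where an arrow
   a : Gamma -> R acts by r (x) m |-> r . (a (x) 1)(psi m). Conversely a sheaf N
   gives the A-module N_(A,1): as every point (R, x) receives a unique map from
   (A, 1) over x, N_x is R (x)_{A,x} N_(A,1), and the action of the generic arrow
   1 : Gamma -> Gamma is a coaction by which naturality determines the action of
   every arrow. Under this correspondence coassociativity is the cocycle condition
   at the universal composable pair, over Gamma (x)_A Gamma. This requires
   Gamma (x)_A Gamma to have cardinality less than kappa, which follows from
   |Gamma|^2 = |Gamma| for infinite Gamma, while Gamma (x)_A Gamma is finite for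
   finite Gamma. *)

(** * Cardinality of the ring of composable pairs *)

Local Open Scope classical_set_scope.
Local Open Scope card_scope.

Lemma card_leT_injP (T U : Type) :
  [set: T] #<= [set: U] <-> exists f : T -> U, injective f.
Proof.
split=> [|[f finj]]; last first.
  apply: (@card_le_trans _ _ _ (range f)); last exact: card_leT.
  by rewrite (card_le_eqr (inj_card_eq (in2W finj))).
move=> /card_leP [f].
exists (fun x => val (f (SigSub (mem_set (I : [set: T] x))))) => x y /val_inj.
by move=> /(inj (in_setT _) (in_setT _)) [].
Qed.

(** Zorn's lemma on graphs of partial bijections between [A] and [B]: a maximal one is defined on
    all of [A] or reaches all of [B], since otherwise an unmatched pair could be added. [u0] and
    [t0] are default values outside [A] and [B]. *)
Lemma injection_comparable (T U : Type) (t0 : T) (u0 : U) (A : set T) (B : set U) :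
  (exists f : T -> U, (forall x, A x -> B (f x)) /\
     forall x y, A x -> A y -> f x = f y -> x = y) \/
  (exists g : U -> T, (forall x, B x -> A (g x)) /\
     forall x y, B x -> B y -> g x = g y -> x = y).
Proof.
pose P (G : set (T * U)) := (forall p, G p -> A p.1 /\ B p.2) /\
  forall p q, G p -> G q -> (p.1 = q.1 <-> p.2 = q.2).
have [F FP Ftot|G [[GAB Ginj] Gmax]] := @Zorn_bigcup (T * U)%type P.
  split=> [p [G FG Gp]|p q [G FG Gp] [G' FG' G'q]]; first by case: (FP G FG) => /(_ p Gp).
  have [GG'|G'G] := Ftot _ _ FG FG'.
  - by case: (FP _ FG') => _; apply => //; apply: GG'.
  - by case: (FP _ FG) => _; apply => //; apply: G'G.
have [domG|/existsNP[a /not_implyP[Aa aG]]] :=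
    pselect (forall a, A a -> exists b, G (a, b)).
  have ch a : exists b, A a -> G (a, b).
    by have [/domG [b Gb]|nAa] := pselect (A a); [exists b|exists u0].
  have [f fP] := choice ch; left; exists f; split=> [a /fP /GAB []//|x y Ax Ay].
  by move=> fxy; apply: (Ginj _ _ (fP x Ax) (fP y Ay)).2.
have codG b : B b -> exists a, G (a, b).
  move=> Bb; apply: contrapT => bG; apply: (Gmax (G `|` [set (a, b)])).
    split; first exact: subsetUl.
    by move=> /(_ (a, b)) Gab; apply: aG; exists b; apply: Gab; right.
  split=> [p [/GAB//|->]//|p q [Gp|->] [Gq|->] //=]; first exact: Ginj.
  - split=> e; last by case: bG; exists p.1; rewrite -e -surjective_pairing.
    by case: aG; exists p.2; rewrite -e -surjective_pairing.
  - split=> e; last by case: bG; exists q.1; rewrite e -surjective_pairing.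
    by case: aG; exists q.2; rewrite e -surjective_pairing.
have ch b : exists a, B b -> G (a, b).
  by have [/codG [a' Gb]|nBb] := pselect (B b); [exists a'|exists t0].
have [g gP] := choice ch; right; exists g; split=> [b /gP /GAB []//|x y Bx By].
by move=> gxy; apply: (Ginj _ _ (gP x Bx) (gP y By)).1.
Qed.

Section Square.
Variables (X : Type) (e : nat -> X).
Hypothesis e_inj : injective e.

(** An injection S x S -> S, encoded as a total operation so that pairings on different sets have
    the same type. Keeping the [e n] in S supplies constants that serve as tags. *)
Record partial_pairing := PartialPairing {
  pp_set : set X;
  pp_fun : X -> X -> X;
  pp_nat : forall n, pp_set (e n);
  pp_in : forall x y, pp_set x -> pp_set y -> pp_set (pp_fun x y);
  pp_inj : forall x y x' y', pp_set x -> pp_set y -> pp_set x' -> pp_set y' ->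
    pp_fun x y = pp_fun x' y' -> x = x' /\ y = y'
}.

(** Pairings on the same S may differ outside S, so this is a preorder but not an order; hence the
    use of [ZL_preorder]. *)
Definition pp_le (s t : partial_pairing) : bool :=
  `[< pp_set s `<=` pp_set t /\
      forall x y, pp_set s x -> pp_set s y -> pp_fun t x y = pp_fun s x y >].

Lemma nat_partial_pairing : partial_pairing.
Proof.
pose idx x := xget 0%N [set n | e n = x].
have eK n : idx (e n) = n.
  apply: e_inj; rewrite /idx; case: xgetP => [m _ //|/(_ n) [] //].
refine (@PartialPairing (range e) (fun x y => e (pickle (idx x, idx y))) _ _ _).
- by move=> n; exists n.
- by move=> x y _ _; exists (pickle (idx x, idx y)).
move=> _ _ _ _ [a _ <-] [b _ <-] [c _ <-] [d _ <-] /e_inj.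
by rewrite !eK => /(pcan_inj pickleK) [-> ->].
Qed.

(** The bound lives on the union: a pair is evaluated in some chain member containing both entries,
    and members agree where both are defined. The empty chain is bounded by the pairing on
    [range e]. *)
Lemma pp_chain (A : set partial_pairing) : total_on A pp_le ->
  exists t, forall s, A s -> pp_le s t.
Proof.
move=> Atot; have [[s0 As0]|A0] := pselect (exists s, A s); last first.
  by exists nat_partial_pairing => s As; case: A0; exists s.
pose S := \bigcup_(s in A) pp_set s.
have ch p : exists t, (exists2 s, A s & pp_set s p.1 /\ pp_set s p.2) ->
    A t /\ pp_set t p.1 /\ pp_set t p.2.
  by case: (pselect (exists2 s, A s & pp_set s p.1 /\ pp_set s p.2)) =>
    [[s As sp]|np]; [exists s|exists s0].
have [c cP] := choice ch.
pose f x y := pp_fun (c (x, y)) x y.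
have fE s x y : A s -> pp_set s x -> pp_set s y -> f x y = pp_fun s x y.
  move=> As sx sy; rewrite /f; case: (cP (x, y)) => [|At [tx ty]]; first by exists s.
  by case: (Atot s _ As At) => /asboolP [_ ->].
have dir s t : A s -> A t ->
    exists2 u, A u & pp_set s `<=` pp_set u /\ pp_set t `<=` pp_set u.
  move=> As At; case: (Atot s t As At) => /asboolP [st _].
    by exists t => //; split.
  by exists s => //; split.
have SS x y : S x -> S y -> exists2 s, A s & pp_set s x /\ pp_set s y.
  move=> [s As sx] [t At ty]; have [u Au [su tu]] := dir s t As At.
  by exists u => //; split; [apply: su|apply: tu].
unshelve eexists (@PartialPairing S f _ _ _).
- by move=> n; exists s0 => //; apply: pp_nat.
- move=> x y /SS /[apply] -[s As [sx sy]]; exists s => //.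
  by rewrite (fE s) //; apply: pp_in.
- move=> x y x' y' /SS /[apply] -[s As [sx sy]] /SS /[apply] -[t At [tx ty]].
  have [u Au [su tu]] := dir s t As At.
  by rewrite !(fE u) //; [apply: pp_inj|..]; by [apply: su|apply: tu].
- move=> s As; apply/asboolP => /=; split=> [x sx|x y sx sy]; first by exists s.
  exact: fE.
Qed.

(* A maximal pairing on S already yields one on the whole type: if S has an
   injection j into its complement, then sending the new pairs into j(S) would
   extend it. *)
Lemma infinite_pairing : exists f : X * X -> X, injective f.
Proof.
have [||s smax] := ZL_preorder nat_partial_pairing _ _ pp_chain.
- by move=> t; apply/asboolP; split.
- move=> r s t /asboolP [sr fr] /asboolP [st ft]; apply/asboolP; split.
    exact: subset_trans st.
  by move=> x y rx ry; rewrite ft ?fr //; apply: sr.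
case: s smax => S f Se fS finj smax.
have tag_inj (b b' : bool) : e b = e b' -> b = b'.
  by move/e_inj; case: b b' => [] [].
(* The values [e 1] and [e 0] encode, inside S, whether x belongs to S. *)
pose tag x := e `[< S x >].
have Stag x : S (tag x) by apply/Se.
have finj4 x y x' y' a b a' b' : S a -> S b -> S a' -> S b' ->
    f (f (tag x) (tag y)) (f a b) = f (f (tag x') (tag y')) (f a' b') ->
    (tag x = tag x' /\ tag y = tag y') /\ (a = a' /\ b = b').
  move=> Sa Sb Sa' Sb' E.
  have [E1 E2] := finj _ _ _ _ (fS _ _ (Stag x) (Stag y)) (fS _ _ Sa Sb)
    (fS _ _ (Stag x') (Stag y')) (fS _ _ Sa' Sb') E.
  by split; apply/finj.
have [[j [jN jinj]]|[j [jS jinj]]] := injection_comparable (e 0) (e 0) S (~` S).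
- have ch x : exists s, (exists2 s', S s' & j s' = x) -> S s /\ j s = x.
    by case: (pselect (exists2 s', S s' & j s' = x)) => [[s Ss sx]|nx];
      [exists s|exists x].
  have [j' j'P] := choice ch.
  (* Since [j'] inverts [j] on j(S), the pair ([tag x], [r x]) of elements of S determines x in T;
     so [h] below maps T x T injectively into S. *)
  pose r x := if `[< S x >] then x else j' x.
  pose T := S `|` j @` S.
  have rT x : T x -> S (r x).
    rewrite /r; case: asboolP => // nSx [//|/j'P []//].
  have rinj x y : T x -> T y -> tag x = tag y -> r x = r y -> x = y.
    move=> Tx Ty /tag_inj; rewrite /r; case: asboolP => Sx; case: asboolP => Sy //= _.
    case: Tx => [//|/j'P [_ {2}<-]]; case: Ty => [//|/j'P [_ {2}<-]].
    by move=> ->.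
  pose h x y := f (f (tag x) (tag y)) (f (r x) (r y)).
  have hS x y : T x -> T y -> S (h x y).
    by move=> Tx Ty; apply/fS; apply/fS; try apply: Stag; apply: rT.
  have hinj x y x' y' : T x -> T y -> T x' -> T y' -> h x y = h x' y' -> x = x' /\ y = y'.
    move=> Tx Ty Tx' Ty' E.
    have [E1 E2] := finj4 _ _ _ _ _ _ _ _ (rT _ Tx) (rT _ Ty) (rT _ Tx') (rT _ Ty') E.
    by case: E1 => ? ?; case: E2 => ? ?; split; apply: rinj.
  (* Pairs not contained in S are sent to j(S), which is disjoint from S, so old and new values
     never collide. *)
  pose g x y := if `[< S x /\ S y >] then f x y else j (h x y).
  have [t [tT tg]] : exists t : partial_pairing, pp_set t = T /\ pp_fun t = g.
    unshelve eexists (@PartialPairing T g _ _ _) => //.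
    + by move=> n; left; apply/Se.
    + move=> x y Tx Ty; rewrite /g; case: asboolP => [[Sx Sy]|_]; first by left; apply/fS.
      by right; exists (h x y) => //; apply: hS.
    + move=> x y x' y' Tx Ty Tx' Ty'; rewrite /g.
      case: asboolP => [[Sx Sy]|_]; case: asboolP => [[Sx' Sy']|_].
      * exact/finj.
      * move=> E; case: (jN (h x' y')); first exact: hS.
        by rewrite -E; apply/fS.
      * move=> E; case: (jN (h x y)); first exact: hS.
        by rewrite E; apply/fS.
      * by move=> /jinj E; apply: hinj => //; apply: E; apply: hS.
  have /smax /asboolP [/= + _] : pp_le (PartialPairing Se fS finj) t.
    apply/asboolP; rewrite tT tg; split=> [x ?|x y /= Sx Sy]; first by left.
    by rewrite /g; case: asboolP => // -[].
  rewrite tT => /(_ (j (e 0))) TS; case: (jN (e 0) (Se 0)); apply: TS.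
  by right; exists (e 0).
(* Here the complement of S embeds in S, so ([tag x], [k x]) encodes every x by two elements of S,
   and [f] pairs these codes. *)
- pose k x := if `[< S x >] then x else j x.
  have kS x : S (k x) by rewrite /k; case: asboolP => // /jS.
  have kinj x y : tag x = tag y -> k x = k y -> x = y.
    move/tag_inj; rewrite /k; case: asboolP => Sx; case: asboolP => Sy //= _.
    exact: jinj.
  exists (fun p => f (f (tag p.1) (tag p.2)) (f (k p.1) (k p.2))) => -[x y] [x' y'] /=.
  move=> /(finj4 _ _ _ _ _ _ _ _ (kS _) (kS _) (kS _) (kS _)) [[tx ty] [rx ry]].
  by rewrite (kinj x x') // (kinj y y').
Qed.

(** The iterated pairing alone does not show where a list ends; storing the length makes the
    decoding unambiguous. *)
Lemma infinite_seq_injection : exists c : seq X -> X, injective c.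
Proof.
have [p pinj] := infinite_pairing.
pose d := foldr (fun x y => p (x, y)) (e 0).
exists (fun s => p (e (size s), d s)) => s s' /pinj [/e_inj].
elim: s s' => [|x s IH] [|x' s'] //= [ss] /pinj [-> dd].
by rewrite (IH s').
Qed.

End Square.

Lemma card_below_inj (K T U : Type) (f : U -> T) :
  injective f -> card_below K T -> card_below K U.
Proof.
move=> finj [TK KT]; have UT : [set: U] #<= [set: T].
  by apply/card_leT_injP; exists f.
split; first exact: card_le_trans TK.
by move=> KU; apply: KT; apply: card_le_trans UT.
Qed.

Lemma card_below_finite (K T : Type) : infinite_set [set: K] ->
  finite_set [set: T] -> card_below K T.
Proof.
move=> Kinf Tfin; split; last by move=> KT; apply: Kinf; apply: card_le_finite Tfin.
have /finite_set_leP [n Tn] := Tfin.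
apply: card_le_trans Tn _; apply: card_le_trans (card_leT _) _.
exact/infiniteP.
Qed.

Lemma card_below_seq (K T : Type) : infinite_set [set: T] ->
  card_below K T -> card_below K (seq T).
Proof.
move=> /infiniteP /card_leT_injP [e einj].
by have [c cinj] := infinite_seq_injection einj; apply: card_below_inj cinj.
Qed.

Local Open Scope ring_scope.

Lemma finite_ring_exponent (B : pzRingType) : finite_set [set: B] ->
  exists n, n.+1%:R = 0 :> B.
Proof.
move=> Bfin; apply: contrapT => noexp.
case/finite_setPn: Bfin; apply/card_leT_injP; exists (fun n => n%:R) => m n.
wlog le_mn : m n / (m <= n)%N.
  by move=> th; have [/th //|/ltnW /th th' /esym /th'] := leqP m n.
move: le_mn; rewrite leq_eqVlt => /predU1P[//|lt_mn] E; case: noexp.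
by exists (n - m.+1)%N; rewrite -subSn // subSS natrB ?E ?subrr // ltnW.
Qed.

(** The additive group is generated by finitely many pure tensors and killed by the additive
    exponent [n.+1] of [B], so coefficients below [n.+1] suffice. *)
Lemma finite_rtens (A B C : comPzRingType) (f : {rmorphism A -> B})
    (g : {rmorphism A -> C}) :
  finite_set [set: B] -> finite_set [set: C] -> finite_set [set: rtens f g].
Proof.
move=> Bfin Cfin; have [n n0] := finite_ring_exponent Bfin.
have expn (t : rtens f g) : t *+ n.+1 = 0.
  by rewrite -(scaler_nat n.+1 t) n0 scale0r.
pose span := fix span (L : seq (B * C)) : set (rtens f g) :=
  if L is p :: L' then [set rpure f g p.1 p.2 *+ i + t | i in `I_n.+1 & t in span L']
  else [set 0].
have span_fin L : finite_set (span L).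
  elim: L => [|p L IH] /=; first exact: finite_set1.
  by apply: finite_image2 => //; apply: finite_II.
have span0 L : span L 0.
  elim: L => [//|p L IH] /=; exists 0%N => //; exists 0 => //.
  by rewrite mulr0n addr0.
have spanD L t u : span L t -> span L u -> span L (t + u).
  elim: L t u => [_ _ -> ->|p L IH _ _ [i _ [t Lt <-]] [j _ [u Lu <-]]] /=.
    by rewrite addr0.
  exists ((i + j) %% n.+1)%N; first exact: ltn_pmod.
  exists (t + u); first exact: IH.
  rewrite addrACA -mulrnDr [in RHS](divn_eq (i + j) n.+1).
  by rewrite [in RHS]mulrnDr mulnC mulrnA expn mul0rn add0r.
have span_pure L p : p \in L -> span L (rpure f g p.1 p.2).
  elim: L => [//|q L IH]; rewrite inE => /predU1P[->|/IH Lp] /=.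
    exists (1 %% n.+1)%N; first exact: ltn_pmod.
    exists 0; first exact: span0.
    (* For [n = 0] the coefficient [1 %% 1] is 0, but then the tensor itself vanishes. *)
    rewrite addr0; have [n00|n_gt0] := posnP n.
      by move: (expn (rpure f g q.1 q.2)); rewrite n00 modn1 mulr0n mulr1n.
    by rewrite modn_small // mulr1n.
  by exists 0%N => //; exists (rpure f g p.1 p.2) => //; rewrite mulr0n add0r.
have /finite_seqP [L LE] : finite_set [set: B * C].
  by rewrite -setXTT; apply: finite_setX.
apply: sub_finite_set (span_fin L) => t _.
elim/rtens_ind: t => [|b c|t u]; [exact: span0| |exact: spanD].
by apply: (span_pure _ (b, c)); have : [set: B * C] (b, c) by []; rewrite LE.
Qed.

(** [repr] embeds the quotient into words on [B * B]. Finite [B] is treated apart because words on a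
    nonempty finite set are already countably many, which is not below a countable [K]. *)
Lemma card_below_rtens (K : Type) (A : comPzRingType) (B : sring K)
    (f g : {rmorphism A -> B}) :
  infinite_set [set: K] -> card_below K (rtens f g).
Proof.
move=> Kinf; have Bsm := sring_small B.
have [Bfin|Binf] := pselect (finite_set [set: B]).
  exact/card_below_finite/finite_rtens.
have Bsq : card_below K (B * B).
  have /infiniteP /card_leT_injP [e einj] := Binf.
  by have [p pinj] := infinite_pairing einj; apply: card_below_inj pinj _.
have BBinf : infinite_set [set: B * B].
  apply: contra_not Binf => BBfin.
  apply: sub_finite_set (finite_image fst BBfin) => b _ /=.
  by exists (b, b).
apply: card_below_inj (card_below_seq BBinf Bsq).
exact: (can_inj reprK).
Qed.

Local Close Scope card_scope.
Local Close Scope classical_set_scope.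

(** * Base change *)

(** Pure tensors generate additively. Asking for additivity alone lets the principle compare maps
    that are semilinear over various ring maps. *)
Lemma tens_ext (A B : comPzRingType) (f : {rmorphism A -> B}) (N : lmodType A)
    (P : zmodType) (p q : tens f N -> P) :
    {morph p : t u / t + u} -> {morph q : t u / t + u} ->
    (forall b n, p (tpure f b n) = q (tpure f b n)) ->
  p =1 q.
Proof.
move=> pD qD pq t.
have morph0 (r : tens f N -> P) : {morph r : t u / t + u} -> r 0 = 0.
  by move=> rD; apply: (addrI (r 0)); rewrite -rD !addr0.
elim/tens_ind: t => [|//|t u IHt IHu]; first by rewrite !morph0.
by rewrite pD qD IHt IHu.
Qed.

Section Semilinear.
Variables (A B : comPzRingType) (f : {rmorphism A -> B}).
Variables (M : lmodType A) (N : lmodType B) (h : M -> N).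
Hypotheses (hD : {morph h : x y / x + y}) (hZ : forall a x, h (a *: x) = f a *: h x).

Fact semilinear_subproof : semilinear_for (f \; *:%R) h.
Proof. by split=> [a x|x y]; rewrite ?hZ ?hD. Qed.

Definition mk_semilinear : {linear M -> N | f \; *:%R} :=
  HB.pack h (@GRing.isSemilinear.Build A M N (f \; *:%R) h semilinear_subproof).

End Semilinear.

Section MkLinear.
Variables (R : comPzRingType) (M N : lmodType R) (h : M -> N).
Hypotheses (hD : {morph h : x y / x + y}) (hZ : forall a x, h (a *: x) = a *: h x).

Fact linear_subproof : semilinear_for *:%R h.
Proof. by split=> [a x|x y]; rewrite ?hZ ?hD. Qed.

Definition mk_linear : {linear M -> N} :=
  HB.pack h (@GRing.isSemilinear.Build R M N *:%R h linear_subproof).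

End MkLinear.

Section Adjoint.
Variables (A B : comPzRingType) (f : {rmorphism A -> B}).
Variables (M : lmodType A) (N : lmodType B) (h : {linear M -> N | f \; *:%R}).

Lemma adjoint_bal : balanced f (fun b m => b *: h m).
Proof.
split=> [n x y|b x y|b a n] /=; first by rewrite scalerDl.
- by rewrite linearD scalerDr.
- by rewrite linearZ_LR /= scalerA.
Qed.

Lemma adjoint_pure b m : (adjoint (f := f) h) (tpure f b m) = b *: h m.
Proof. exact: (tlift_pure adjoint_bal). Qed.

Lemma adjointD : {morph (adjoint (f := f) h) : t u / t + u}.
Proof. exact: (tliftD adjoint_bal). Qed.

Lemma adjointZ b t : (adjoint (f := f) h) (b *: t) = b *: (adjoint (f := f) h) t.
Proof.
apply: (tens_ext (p := fun t => (adjoint (f := f) h) (b *: t))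
  (q := fun t => b *: (adjoint (f := f) h) t)) => [t1 t2|t1 t2|c n].
- by rewrite scalerDr adjointD.
- by rewrite adjointD scalerDr.
- by rewrite tpureZ !adjoint_pure scalerA.
Qed.

Definition adjoint_linear : {linear tens f M -> N} := mk_linear adjointD adjointZ.

End Adjoint.

Section BaseChange.
Variables (A R S : comPzRingType) (x : {rmorphism A -> R}) (y : {rmorphism A -> S}).
Variables (f : {rmorphism R -> S}) (M : lmodType A).
Hypothesis fx : f \o x =1 y.

Lemma base_change_pure r m :
  tens_map (N := M) y f idfun (tpure x r m) = tpure y (f r) m.
Proof. exact: (tens_map_pure (s := idfun)). Qed.

Lemma base_changeD :
  {morph (tens_map (N := M) (f := x) y f idfun) : t u / t + u}.
Proof. exact: (tens_mapD (s := idfun)). Qed.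

Lemma base_changeZ r t :
  tens_map (N := M) (f := x) y f idfun (r *: t) = f r *: tens_map y f idfun t.
Proof.
move: t; apply: tens_ext => [t u|t u|r' n].
- by rewrite scalerDr base_changeD.
- by rewrite base_changeD scalerDr.
- by rewrite tpureZ !base_change_pure tpureZ rmorphM.
Qed.

Definition base_change : {linear tens x M -> tens y M | f \; *:%R} :=
  mk_semilinear base_changeD base_changeZ.

End BaseChange.

Lemma base_change_comp (A R S T : comPzRingType) (x : {rmorphism A -> R})
    (y : {rmorphism A -> S}) (z : {rmorphism A -> T}) (f : {rmorphism R -> S})
    (g : {rmorphism S -> T}) (h : {rmorphism R -> T}) (M : lmodType A)
    (t : tens x M) :
  f \o x =1 y -> g \o y =1 z -> h =1 g \o f ->
  tens_map z h idfun t = tens_map z g idfun (tens_map y f idfun t).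
Proof.
move=> fx gy hE.
have hx : h \o x =1 z by move=> a; rewrite /= hE -gy /= -fx.
move: t; apply: tens_ext => [t u|t u|b n].
- exact: base_changeD.
- by rewrite !base_changeD.
- by rewrite !base_change_pure // hE.
Qed.

Lemma base_change_id (A R : comPzRingType) (x : {rmorphism A -> R})
    (M : lmodType A) (t : tens x M) : tens_map x idfun idfun t = t.
Proof.
move: t; apply: tens_ext => [t u|//|b n]; first exact: base_changeD.
exact: base_change_pure.
Qed.

Section Extend.
Variables (A R : comPzRingType) (x : {rmorphism A -> R}) (M N : lmodType A).
Variable h : {linear M -> N}.

Lemma extend_pure r m :
  tens_map (f := x) x idfun h (tpure x r m) = tpure x r (h m).
Proof.
exact: (tens_map_pure (phi := idfun) (s := idfun) (frefl x) (linearD h)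
  (linearZ_LR h)).
Qed.

Lemma extendD : {morph (tens_map (f := x) x idfun h) : t u / t + u}.
Proof.
exact: (tens_mapD (phi := idfun) (s := idfun) (frefl x) (linearD h)
  (linearZ_LR h)).
Qed.

Lemma extendZ r t :
  tens_map (f := x) x idfun h (r *: t) = r *: tens_map x idfun h t.
Proof.
move: t; apply: tens_ext => [t u|t u|r' n].
- by rewrite scalerDr extendD.
- by rewrite extendD scalerDr.
- by rewrite tpureZ !extend_pure tpureZ.
Qed.

Definition extend : {linear tens x M -> tens x N} := mk_linear extendD extendZ.

End Extend.

Lemma extend_comp (A R : comPzRingType) (x : {rmorphism A -> R})
    (M N P : lmodType A) (k : {linear N -> P}) (h : {linear M -> N}) (t : tens x M) :
  tens_map x idfun (k \o h) t = tens_map x idfun k (tens_map x idfun h t).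
Proof.
move: t; apply: tens_ext => [t u|t u|r m]; first exact: extendD.
- by rewrite !extendD.
- by rewrite !extend_pure.
Qed.

Lemma extend_base_change (A R S : comPzRingType) (x : {rmorphism A -> R})
    (y : {rmorphism A -> S}) (f : {rmorphism R -> S}) (M N : lmodType A)
    (h : {linear M -> N}) (t : tens x M) :
  f \o x =1 y ->
  tens_map y idfun h (tens_map y f idfun t) =
  tens_map y f idfun (tens_map x idfun h t).
Proof.
move=> fx; move: t; apply: tens_ext => [t u|t u|r m].
- by rewrite !(base_changeD, extendD).
- by rewrite !(base_changeD, extendD).
- by rewrite !(base_change_pure, extend_pure).
Qed.

Section TensAssoc.
Variables (A B C : comPzRingType) (f : {rmorphism A -> B}).
Variables (g h : {rmorphism A -> C}) (N : lmodType A).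

Local Notation BCN := (tens f (restr g (tens h N))).

Lemma tens_assocD :
  {morph (@tens_assoc _ _ _ f g h N) : t u / t + u}.
Proof.
pose F (n : N) b c := tpure f b (tpure h c n : restr g (tens h N)).
have Fbal n : rbalanced f g (F n).
  split=> [c b b'|b c c'|b a c] /=; rewrite /F.
  - by rewrite tpureDl.
  - by rewrite tpureDl tpureDr.
  - by rewrite tpure_bal; congr (tpure _ _ _); apply: tpureZ.
apply: tliftD; split=> [n t u|t m n|t a n] /=.
- exact: (rliftD (Fbal n)).
- move: t; apply: (tens_ext (p := rlift (F (m + n)))
    (q := fun t => rlift (F m) t + rlift (F n) t)) => [t u|t u|b c].
  + exact: (rliftD (Fbal _)).
  + by rewrite !(rliftD (Fbal _)) addrACA.
  + by rewrite -[tpure _ b c]/(rpure f g b c) !(rlift_pure _ _ (Fbal _)) /F !tpureDr.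
- move: t; apply: (tens_ext (p := fun t : rtens f g => rlift (F n) (t * rinr f g (h a)))
    (q := rlift (F (a *: n)))) => [t u|t u|b c].
  + by rewrite mulrDl (rliftD (Fbal _)).
  + exact: (rliftD (Fbal _)).
  + rewrite -[tpure _ b c]/(rpure f g b c) rpureM mulr1.
    by rewrite !(rlift_pure _ _ (Fbal _)) /F tpure_bal.
Qed.

End TensAssoc.

(** * Coactions and arrows *)

Section Rinl.
Variables (A B C : comPzRingType) (f : {rmorphism A -> B}) (g : {rmorphism A -> C}).

Definition rinl (b : B) : rtens f g := rpure f g b 1.

Fact rinl_zmod : zmod_morphism rinl.
Proof. by move=> b b'; apply: (addIr (rinl b')); rewrite subrK -rpureDl subrK. Qed.

Fact rinl_monoid : monoid_morphism rinl.
Proof. by split=> [|b b']; rewrite // rpureM mulr1. Qed.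

HB.instance Definition _ := GRing.isZmodMorphism.Build B (rtens f g) rinl rinl_zmod.
HB.instance Definition _ :=
  GRing.isMonoidMorphism.Build B (rtens f g) rinl rinl_monoid.

Lemma rinl_rinr : rinl \o f =1 rinr f g \o g.
Proof. by move=> a; rewrite /= /rinl /rinr -[f a]mul1r rpure_bal mulr1. Qed.

(** It identifies the composite of the universal composable pair, formed by the two inclusions, with
    [Delta]. *)
Lemma rpair_id (t : rtens f g) : rpair rinl (rinr f g) t = t.
Proof.
elim/rtens_ind: t => [|b c|t u IHt IHu].
- exact: (rlift0 (rpair_bal rinl_rinr)).
- by rewrite (rpairE rinl_rinr) rpureM mul1r mulr1.
- by rewrite [LHS](rliftD (rpair_bal rinl_rinr)) -/(rpair _ _ _) -/(rpair _ _ _) IHt IHu.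
Qed.

End Rinl.

Section UniversalPair.
Variables (K : Type) (K_infinite : infinite_set [set: K]) (H : hopf_algebroid K).

(** The groupoid laws are available over rings of cardinality below kappa; the bound makes Gamma
    (x)_A Gamma such a ring. *)
Definition hG2 : sring K :=
  SRing (card_below_rtens (B := hG H) (etaR H) (etaL H) K_infinite).

Definition hG_inl : {rmorphism hG H -> hG2} := rinl (etaR H) (etaL H).
Definition hG_inr : {rmorphism hG H -> hG2} := rinr (etaR H) (etaL H).

Lemma hG_composable : SpecMap (etaR H) hG2 hG_inl = SpecMap (etaL H) hG2 hG_inr.
Proof. by apply: rmorph_ext => a; apply: rinl_rinr. Qed.

Lemma spec_comp_universal (g : hG H) : spec_comp hG_composable g = Delta H g.
Proof. exact: rpair_id. Qed.

(** The codomain law for the universal pair, whose composite is [Delta] and whose second arrow is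
    [hG_inr]. *)
Lemma Delta_etaR (a : hA H) :
  Delta H (etaR H a) = rinr (etaR H) (etaL H) (etaR H a).
Proof.
have /(congr1 (fun h : {rmorphism _ -> _} => h a)) :=
  cod_comp (ha_groupoid H) hG_composable.
by rewrite /= /spec_pre /= rpair_id.
Qed.

End UniversalPair.

Lemma eq_rmorph (R S : pzRingType) (f g : {rmorphism R -> S}) : f = g -> f =1 g.
Proof. by move=> ->. Qed.

(** This and the next lemma are the domain and codomain laws for the identity arrow of the object 1
    : A -> A. *)
Lemma epsilon_etaL (K : Type) (H : hopf_algebroid K) (a : hA H) :
  epsilon H (etaL H a) = a.
Proof.
exact: (congr1 (fun h : {rmorphism hA H -> hA H} => h a)
  (dom_id (ha_groupoid H) (R := hA H) (rings_id (hA H)))).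
Qed.

Lemma epsilon_etaR (K : Type) (H : hopf_algebroid K) (a : hA H) :
  epsilon H (etaR H a) = a.
Proof.
exact: (congr1 (fun h : {rmorphism hA H -> hA H} => h a)
  (cod_id (ha_groupoid H) (R := hA H) (rings_id (hA H)))).
Qed.

Lemma scale_balanced (K : Type) (A : sring K) (M : lmodType A) :
  balanced (rings_id A) (fun a (n : M) => a *: n).
Proof.
split=> [n a a'|a n n'|a c n]; [exact: scalerDl|exact: scalerDr|].
by rewrite scalerA.
Qed.

Section Coaction.
Variables (K : Type) (K_infinite : infinite_set [set: K]) (H : hopf_algebroid K).
Variable M : comodule H.

Section OneArrow.
Variables (R : comPzRingType) (x y : {rmorphism hA H -> R}).
Variable (a : {rmorphism hG H -> R}).
Hypotheses (ax : a \o etaL H =1 x) (ay : a \o etaR H =1 y).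

Definition coact (m : M) : tens y M := tens_map y a idfun (coaction M m).

Fact coactD : {morph coact : m n / m + n}.
Proof. by move=> m n; rewrite /coact linearD (base_changeD ay). Qed.

Fact coactZ c m : coact (c *: m) = x c *: coact m.
Proof. by rewrite /coact linearZ_LR /= (base_changeZ ay) -ax. Qed.

Definition coact_linear : {linear M -> tens y M | x \; *:%R} :=
  mk_semilinear coactD coactZ.

(** The ends [x] and [y] are tied to [a] only pointwise, so that arrows whose ends are
    propositionally equal, such as an arrow and its inverse, act between the same modules. *)
Definition cpsi : {linear tens x M -> tens y M} := adjoint_linear coact_linear.

Lemma cpsi_pure r m : cpsi (tpure x r m) = r *: tens_map y a idfun (coaction M m).
Proof. exact: adjoint_pure. Qed.

End OneArrow.

Lemma cpsi_base_change (R S : comPzRingType) (x y : {rmorphism hA H -> R})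
    (x' y' : {rmorphism hA H -> S}) (a : {rmorphism hG H -> R})
    (a' : {rmorphism hG H -> S}) (f : {rmorphism R -> S})
    (ax : a \o etaL H =1 x) (ay : a \o etaR H =1 y)
    (ax' : a' \o etaL H =1 x') (ay' : a' \o etaR H =1 y') (t : tens x M) :
  f \o a =1 a' ->
  cpsi ax' ay' (tens_map x' f idfun t) = tens_map y' f idfun (cpsi ax ay t).
Proof.
move=> fa.
have fx : f \o x =1 x' by move=> c; rewrite -ax' /= -fa /= -ax.
have fy : f \o y =1 y' by move=> c; rewrite -ay' /= -fa /= -ay.
move: t; apply: tens_ext => [t u|t u|r m].
- by rewrite (base_changeD fx) linearD.
- by rewrite linearD (base_changeD fy).
- rewrite (base_change_pure fx) !cpsi_pure (base_changeZ fy); congr (_ *: _).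
  by rewrite (base_change_comp _ ay fy) // => g; rewrite /= -fa.
Qed.

(** The identity arrow of [x] is [x \o epsilon], so the counit law reduces its action to the
    transport between the equal points [x] and [y]. *)
Lemma cpsi_id (R : comPzRingType) (x y : {rmorphism hA H -> R})
    (a : {rmorphism hG H -> R}) (ax : a \o etaL H =1 x) (ay : a \o etaR H =1 y)
    (t : tens x M) :
  a =1 x \o epsilon H -> cpsi ax ay t = tens_map y idfun idfun t.
Proof.
move=> ae; have yx : y =1 x by move=> c; rewrite -ay /= ae /= epsilon_etaR.
have xy : idfun \o x =1 y by move=> c; rewrite /= yx.
have eA : epsilon H \o etaR H =1 rings_id (hA H) by move=> c; apply: epsilon_etaR.
move: t; apply: tens_ext => [t u|t u|r m]; [exact: linearD|exact: base_changeD|].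
rewrite cpsi_pure (base_change_pure xy).
have idx : x \o rings_id (hA H) =1 y by move=> c; rewrite yx.
rewrite (base_change_comp _ eA idx ae).
rewrite -{2}(counital m).
set t := tens_map (rings_id _) _ _ _.
(* An element of A (x)_A M equals 1 (x) its image under A (x)_A M -> M, so its base change along [x]
   is 1 (x) that image. *)
have -> : tens_map y x idfun t = tpure y 1 (tlift (fun a n => a *: n) t).
  move: t; apply: tens_ext => [t u|t u|b n].
  - exact: (base_changeD idx).
  - by rewrite (tliftD (scale_balanced M)) tpureDr.
  - rewrite (base_change_pure idx) (tlift_pure (scale_balanced M)) -tpure_bal mul1r.
    by rewrite yx.
by rewrite tpureZ mulr1.
Qed.

(** This has the shape of [gq_cocycle]: base changes along [idfun] carry tensors between fibres at
    points that are equal without being convertible. *)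
Lemma cpsi_comp (R : comPzRingType) (x y y' z xc zc : {rmorphism hA H -> R})
    (a b c : {rmorphism hG H -> R})
    (ax : a \o etaL H =1 x) (ay : a \o etaR H =1 y)
    (by' : b \o etaL H =1 y') (bz : b \o etaR H =1 z)
    (cx : c \o etaL H =1 xc) (cz : c \o etaR H =1 zc) (t : tens x M) :
  x =1 xc -> y =1 y' -> z =1 zc -> c =1 rpair a b \o Delta H ->
  tens_map z idfun idfun (cpsi cx cz (tens_map xc idfun idfun t)) =
  cpsi by' bz (tens_map y' idfun idfun (cpsi ax ay t)).
Proof.
move=> xxc yy' zzc cE.
have ab : a \o etaR H =1 b \o etaL H.
  by move=> g; rewrite by' -yy' -ay.
have xxc' : idfun \o x =1 xc := xxc.
have yy'' : idfun \o y =1 y' := yy'.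
have zcz : idfun \o zc =1 z by move=> g; rewrite /= zzc.
have cz' : c \o etaR H =1 z by move=> g; rewrite zzc -cz.
have ay' : a \o etaR H =1 y' by move=> g; rewrite -yy' -ay.
move: t; apply: tens_ext => [t u|t u|r m].
- by rewrite (base_changeD xxc') linearD (base_changeD zcz).
- by rewrite [cpsi ax ay _]linearD (base_changeD yy'') linearD.
rewrite (base_change_pure xxc') !cpsi_pure (base_changeZ zcz) (base_changeZ yy'').
rewrite [RHS]linearZ -(base_change_comp _ cz zcz (h := c)) //; congr (_ *: _).
rewrite -(base_change_comp _ ay yy'' (h := a)) //.
(* [F] induces g (x) g' (x) m |-> a g * b g' (x) m; applied to both sides of
   coassociativity it gives the two sides of the cocycle condition. *)
pose N := restr (etaL H) (tens (etaR H) M).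
pose F g (u : N) := a g *: tens_map z b idfun (u : tens (etaR H) M).
have Fbal : balanced (etaR H) F.
  split=> [u g g'|g u u'|g k u]; rewrite /F.
  - by rewrite rmorphD scalerDl.
  - by rewrite (base_changeD bz) scalerDr.
  - rewrite restr_scaleE (base_changeZ bz) rmorphM -scalerA.
    by rewrite [a (etaR H k)]ab.
(* This compatibility of [Delta] with the right units makes Delta (x) 1 well defined. *)
have Dbal : Delta H \o etaR H =1 (rinr (etaR H) (etaL H) \o etaR H) \o idfun.
  by move=> g; apply: Delta_etaR.
pose D := tens_map (f := etaR H) (N := M) (rinr (etaR H) (etaL H) \o etaR H)
  (Delta H) idfun.
have DD : {morph D : t u / t + u} by apply: (tens_mapD Dbal).
have Dpure g n : D (tpure (etaR H) g n) =
    tpure (rinr (etaR H) (etaL H) \o etaR H) (Delta H g) n.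
  exact: (tens_map_pure Dbal).
have left : forall u, tlift F (tens_assoc (D u)) = tens_map z c idfun u.
  apply: tens_ext => [t u|t u|g n].
  - by rewrite DD tens_assocD (tliftD Fbal).
  - exact: base_changeD.
  rewrite (base_change_pure cz') Dpure cE /=.
  have rD := rliftD (rpair_bal ab).
  move: (Delta H g); apply: tens_ext => [t u|t u|g1 g2].
  - by rewrite tpureDl tens_assocD (tliftD Fbal).
  - by rewrite [rpair _ _ _]rD tpureDl.
  - rewrite -[tpure _ g1 g2]/(rpure (etaR H) (etaL H) g1 g2) tens_assoc_pure.
    by rewrite (tlift_pure Fbal) /F (base_change_pure bz) tpureZ (rpairE ab).
have right : forall u : tens (etaR H) M,
    tlift F (tens_map (N' := N) (etaR H) idfun (coaction M) u) =
    cpsi by' bz (tens_map y' a idfun u).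
  have sq : idfun \o etaR H =1 etaR H \o idfun by [].
  have cD : {morph (coaction M : M -> N) : m n / m + n} := linearD _.
  have cZ k n : (coaction M : M -> N) (k *: n) = idfun k *: (coaction M n : N).
    exact: linearZ_LR.
  apply: tens_ext => [t u|t u|g n].
  - by rewrite (tens_mapD sq cD cZ) (tliftD Fbal).
  - by rewrite (base_changeD ay') linearD.
  - rewrite (tens_map_pure sq cD cZ) (tlift_pure Fbal) (base_change_pure ay').
    by rewrite cpsi_pure.
by rewrite -left -right /D coassociative.
Qed.

End Coaction.

(** * From comodules to sheaves *)

(** The isomorphism of S (x)_R (R (x)_A M) with S (x)_A M; its inverse is s (x) m |-> s (x) (1 (x)
    m). *)
Lemma base_change_bij (A R S : comPzRingType) (x : {rmorphism A -> R})
    (y : {rmorphism A -> S}) (f : {rmorphism R -> S}) (M : lmodType A)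
    (fx : f \o x =1 y) :
  bijective (adjoint (f := f) (base_change M fx)).
Proof.
pose h (m : M) := tpure f (1 : S) (tpure x 1 m).
have hD : {morph h : m n / m + n} by move=> m n; rewrite /h !tpureDr.
have hZ a m : h (a *: m) = y a *: h m.
  rewrite /h -tpure_bal mul1r tpureZ mulr1 -fx /= -[in RHS](mul1r (f _)).
  by rewrite tpure_bal tpureZ mulr1.
pose g := adjoint_linear (mk_semilinear hD hZ).
have gE s m : g (tpure y s m) = s *: h m by apply: adjoint_pure.
exists g.
- apply: tens_ext => [t u|//|s t]; first by rewrite adjointD linearD.
  rewrite adjoint_pure linearZ_LR.
  move: t; apply: tens_ext => [t u|t u|r m].
  + by rewrite !linearD.
  + exact: (@tpureDr _ _ f (tens x M : lmodType R) s t u).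
  + rewrite [base_change _ _ _](base_change_pure fx) gE /h !tpureZ mulr1.
    by rewrite tpure_bal tpureZ mulr1.
- apply: tens_ext => [t u|//|s m]; first by rewrite linearD adjointD.
  rewrite gE /h tpureZ mulr1 adjoint_pure [base_change _ _ _](base_change_pure fx).
  by rewrite tpureZ rmorph1 mulr1.
Qed.

(** The hypothesis says that [b] after [a] is the identity of [x], so [cpsi_comp] and [cpsi_id]
    apply. *)
Lemma cpsiK (K : Type) (K_infinite : infinite_set [set: K])
    (H : hopf_algebroid K) (M : comodule H) (R : comPzRingType)
    (x y : {rmorphism hA H -> R}) (a b : {rmorphism hG H -> R})
    (ax : a \o etaL H =1 x) (ay : a \o etaR H =1 y)
    (by' : b \o etaL H =1 y) (bx : b \o etaR H =1 x) :
  rpair a b \o Delta H =1 x \o epsilon H ->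
  cancel (cpsi M ax ay) (cpsi M by' bx).
Proof.
move=> abE t; pose c : {rmorphism hG H -> R} := x \o epsilon H.
have cx : c \o etaL H =1 x by move=> k; rewrite /= epsilon_etaL.
have cz : c \o etaR H =1 x by move=> k; rewrite /= epsilon_etaR.
have := cpsi_comp K_infinite ax ay by' bx cx cz t (frefl _) (frefl _) (frefl _)
  (fsym abE).
by rewrite !base_change_id cpsi_id // base_change_id => <-.
Qed.

Section ComoduleToSheaf.
Variables (K : Type) (K_infinite : infinite_set [set: K]) (H : hopf_algebroid K).

Notation X := (spec_groupoid H).

Lemma spec_pt_hom (A : sring K) (p q : points (Spec A)) (f : hom p q) :
  pt_map f \o (pt_elt p : {rmorphism A -> pt_ring p}) =1
  (pt_elt q : {rmorphism A -> pt_ring q}).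
Proof. by move=> a; rewrite -(pt_mapP f). Qed.

Section Object.
Variable M : comodule H.

Definition cfib (p : points (Spec (hA H))) : lmodType (pt_ring p) :=
  tens (pt_elt p : {rmorphism hA H -> pt_ring p}) M.

Definition ctheta (p q : points (Spec (hA H))) (f : hom p q) :
    {linear cfib p -> cfib q | pt_map f \; *:%R} :=
  base_change M (spec_pt_hom f).

Fact ctheta_id p (m : cfib p) : ctheta (idc p) m = m.
Proof. exact: base_change_id. Qed.

Fact ctheta_comp p q r (g : hom q r) (f : hom p q) (m : cfib p) :
  ctheta (compc g f) m = ctheta g (ctheta f m).
Proof.
exact: (base_change_comp m (spec_pt_hom f) (spec_pt_hom g) (frefl _)).
Qed.

Definition csheaf : qcoh (Spec (hA H)) :=
  @QCoh K (Spec (hA H)) cfib ctheta ctheta_id ctheta_comp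
    (fun p q f => base_change_bij M (spec_pt_hom f)).

Definition csheaf_psi_map (p : points (Spec (hG H))) :
    {linear pullback (SpecMap (etaL H)) csheaf p ->
            pullback (SpecMap (etaR H)) csheaf p} :=
  cpsi M (x := rings_comp (pt_elt p) (etaL H)) (y := rings_comp (pt_elt p) (etaR H))
    (a := pt_elt p) (frefl _) (frefl _).

Fact csheaf_psi_natural (p q : points (Spec (hG H))) (f : hom p q)
    (m : pullback (SpecMap (etaL H)) csheaf p) :
  csheaf_psi_map q (theta (pullback (SpecMap (etaL H)) csheaf) f m) =
  theta (pullback (SpecMap (etaR H)) csheaf) f (csheaf_psi_map p m).
Proof. exact/cpsi_base_change/spec_pt_hom. Qed.

Definition csheaf_psi :
    qcoh_hom (pullback (gdom X) csheaf) (pullback (gcod X) csheaf) :=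
  @QCohHom K (Spec (hG H)) (pullback (SpecMap (etaL H)) csheaf)
    (pullback (SpecMap (etaR H)) csheaf) csheaf_psi_map csheaf_psi_natural.

Fact csheaf_cocycle (R : sring K) (b a : gmor X R)
      (e : gcod X R a = gdom X R b) (m : csheaf (Point (gdom X R a))) :
    let psi (c : gmor X R) : csheaf (Point (gdom X R c)) ->
                             csheaf (Point (gcod X R c)) :=
      csheaf_psi (Point c) in
    theta csheaf (pt_same (cod_comp (gp_groupoid X) e))
      (psi (gcomp e)
        (theta csheaf (pt_same (esym (dom_comp (gp_groupoid X) e))) m)) =
    psi b (theta csheaf (pt_same e) (psi a m)).
Proof.
apply: (cpsi_comp K_infinite) => //; apply: eq_rmorph.
- exact: esym (dom_comp (gp_groupoid X) e).
- exact: e.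
- exact: esym (cod_comp (gp_groupoid X) e).
Qed.

(** The inverse is the action of the inverse arrow. *)
Fact csheaf_psi_bij p : bijective (csheaf_psi p).
Proof.
case: p => R a; have X_gpd := gp_groupoid X.
have ea : gcod X R a = gdom X R (ginv X R a) by rewrite (dom_inv X_gpd).
have ea' : gcod X R (ginv X R a) = gdom X R a by rewrite (cod_inv X_gpd).
exists (cpsi M (eq_rmorph (esym ea)) (eq_rmorph ea')).
- by apply: (cpsiK K_infinite); exact: (eq_rmorph (comp_inv_l X_gpd ea)).
- by apply: (cpsiK K_infinite); exact: (eq_rmorph (comp_inv_r X_gpd ea')).
Qed.

Definition csheaf_gqcoh : gqcoh X :=
  @GQCoh K X csheaf csheaf_psi csheaf_psi_bij csheaf_cocycle.

End Object.

Section Morphism.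
Variables (M N : comodule H) (h : comodule_hom M N).

Fact csheaf_map_natural (p q : points (Spec (hA H))) (f : hom p q) (m : csheaf M p) :
  extend (pt_elt q : {rmorphism hA H -> pt_ring q}) h (theta (csheaf M) f m) =
  theta (csheaf N) f (extend (pt_elt p : {rmorphism hA H -> pt_ring p}) h m).
Proof. exact/extend_base_change/spec_pt_hom. Qed.

Definition csheaf_map : qcoh_hom (csheaf M) (csheaf N) :=
  @QCohHom K (Spec (hA H)) (csheaf M) (csheaf N)
    (fun p => extend (pt_elt p : {rmorphism hA H -> pt_ring p}) h)
    csheaf_map_natural.

Lemma cpsi_extend (R : comPzRingType) (x y : {rmorphism hA H -> R})
    (a : {rmorphism hG H -> R}) (ax : a \o etaL H =1 x) (ay : a \o etaR H =1 y)
    (t : tens x M) :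
  extend y h (cpsi M ax ay t) = cpsi N ax ay (extend x h t).
Proof.
move: t; apply: tens_ext => [t u|t u|r m]; try by rewrite !linearD.
rewrite [extend x _ _]extend_pure !cpsi_pure linearZ_LR; congr (_ *: _).
by rewrite (cm_commutes h) [extend _ _ _]extend_base_change.
Qed.

Fact csheaf_map_commutes (R : sring K) (a : gmor X R)
    (m : csheaf_gqcoh M (Point (gdom X R a))) :
  csheaf_map (Point (gcod X R a)) (gq_psi (csheaf_gqcoh M) (Point a) m) =
  gq_psi (csheaf_gqcoh N) (Point a) (csheaf_map (Point (gdom X R a)) m).
Proof. exact: cpsi_extend. Qed.

Definition csheaf_gqcoh_hom : gqcoh_hom (csheaf_gqcoh M) (csheaf_gqcoh N) :=
  @GQCohHom K X (csheaf_gqcoh M) (csheaf_gqcoh N) csheaf_map csheaf_map_commutes.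

End Morphism.

Fact csheaf_functor_id (M : comodules H) :
  csheaf_gqcoh_hom (idc M) = idc (csheaf_gqcoh M : quasi_coherent_sheaves X).
Proof. by apply: gqcoh_hom_ext => p t; apply: base_change_id. Qed.

Fact csheaf_functor_comp (M N P : comodules H) (g : hom N P) (f : hom M N) :
  csheaf_gqcoh_hom (compc g f) =
  compc (csheaf_gqcoh_hom g : @hom (quasi_coherent_sheaves X) _ _) (csheaf_gqcoh_hom f).
Proof.
by apply: gqcoh_hom_ext => p t; apply: extend_comp.
Qed.

Definition csheaf_functor : functor (comodules H) (quasi_coherent_sheaves X) :=
  @Functor (comodules H) (quasi_coherent_sheaves X) csheaf_gqcoh
    csheaf_gqcoh_hom csheaf_functor_id csheaf_functor_comp.

End ComoduleToSheaf.

(** * From sheaves to comodules *)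

(** The pair is informative, obtained by choice, so that the inverse can enter definitions. *)
Lemma bij_inverse (T U : Type) (f : T -> U) :
  bijective f -> {g : U -> T | cancel f g /\ cancel g f}.
Proof. by move=> fbij; apply: cid; case: fbij => g fK gK; exists g. Qed.

Lemma theta_eq (K : Type) (Y : presheaf K) (N : qcoh Y) (p q : points Y)
    (f g : hom p q) (m : N p) :
  pt_map f =1 pt_map g -> theta N f m = theta N g m.
Proof. by move=> /rmorph_ext fg; rewrite (pt_hom_ext fg). Qed.

Lemma theta_same_id (K : Type) (Y : presheaf K) (N : qcoh Y) (R : sring K)
    (x : Y R) (e : x = x) (m : N (Point x)) : theta N (pt_same e) m = m.
Proof. by rewrite -[RHS](@theta_id _ _ N (Point x) m); apply: theta_eq. Qed.

Section FromOrigin.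
Variables (K : Type) (A : sring K) (N : qcoh (Spec A)).

Definition origin : points (Spec A) := @Point K (Spec A) A (rings_id A).

(** [x] may differ in form from [pt_elt p]: the codomain of the generic arrow, given by a composite
    of 1 with [etaR], can then be handled through [etaR] itself. *)
Definition origin_hom (p : points (Spec A)) (x : {rmorphism A -> pt_ring p})
    (e : x =1 (pt_elt p : {rmorphism A -> pt_ring p})) : hom origin p :=
  @PtHom K (Spec A) origin p x (etrans (rings_comp1r x) (rmorph_ext e)).

Definition Norigin : lmodType A := N origin.

Section OnePoint.
Variables (p : points (Spec A)) (x : {rmorphism A -> pt_ring p}).
Hypothesis e : x =1 (pt_elt p : {rmorphism A -> pt_ring p}).

Definition otheta : {linear Norigin -> N p | x \; *:%R} :=
  theta N (origin_hom e).

Definition oadj : {linear tens x Norigin -> N p} := adjoint_linear otheta.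

Lemma oadj_pure r m : oadj (tpure x r m) = r *: otheta m.
Proof. exact: adjoint_pure. Qed.

Lemma oadj_bij : bijective oadj.
Proof. exact: (theta_iso N (origin_hom e)). Qed.

End OnePoint.

Lemma otheta_origin (e : rings_id A =1 rings_id A) m :
  otheta (p := origin) (x := rings_id A) e m = m.
Proof. by rewrite -[RHS](@theta_id _ _ N origin m); apply: theta_eq. Qed.

Section TwoPoints.
Variables (p q : points (Spec A)) (f : hom p q).
Variables (x : {rmorphism A -> pt_ring p}) (y : {rmorphism A -> pt_ring q}).
Hypothesis ex : x =1 (pt_elt p : {rmorphism A -> pt_ring p}).
Hypothesis ey : y =1 (pt_elt q : {rmorphism A -> pt_ring q}).

Lemma theta_otheta m : theta N f (otheta ex m) = otheta ey m.
Proof.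
rewrite -theta_comp; apply: theta_eq => a /=.
by rewrite ex ey; apply: spec_pt_hom.
Qed.

Lemma theta_oadj (t : tens x Norigin) :
  theta N f (oadj ex t) = oadj ey (tens_map y (pt_map f) idfun t).
Proof.
have fxy : pt_map f \o x =1 y by move=> a; rewrite ey /= ex; apply: spec_pt_hom.
move: t; apply: tens_ext => [t u|t u|r m].
- by rewrite !linearD.
- by rewrite (base_changeD fxy) linearD.
by rewrite [oadj ex _]oadj_pure linearZ_LR /= theta_otheta
  (base_change_pure fxy) [RHS]oadj_pure.
Qed.

End TwoPoints.
End FromOrigin.

Section SheafToComodule.
Variables (K : Type) (K_infinite : infinite_set [set: K]) (H : hopf_algebroid K).

Notation X := (spec_groupoid H).

Section Object.
Variable N : gqcoh X.

Notation M := (Norigin N).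

(** The fibres at the ends of [a] and [a'] are different types, hence the two transports; once [a']
    is replaced by [a] they are identities. *)
Lemma gq_psi_eq (R : sring K) (a a' : gmor X R) (ed : gdom X R a' = gdom X R a)
    (ec : gcod X R a = gcod X R a') (m : N (Point (gdom X R a'))) :
  a = a' ->
  theta N (pt_same ec) (gq_psi N (Point a) (theta N (pt_same ed) m)) =
  gq_psi N (Point a') m.
Proof. by move=> aa'; subst a'; rewrite !theta_same_id. Qed.

(* psi is the identity at identity morphisms, as psi_1 is an isomorphism with
   psi_1 psi_1 = psi_1. *)
Lemma gq_psi_id (R : sring K) (x : gob X R)
    (e : gcod X R (gid X R x) = gdom X R (gid X R x))
    (m : N (Point (gdom X R (gid X R x)))) :
  theta N (pt_same e) (gq_psi N (Point (gid X R x)) m) = m.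
Proof.
have X_gpd := gp_groupoid X; set a := gid X R x in e m *.
have gidE : gid X R (gcod X R a) = a by rewrite (cod_id X_gpd).
(* [comp_id_l] speaks of [gid (gcod a)], which equals [a] only propositionally; generalizing it to
   [b] permits the replacement in the dependent type of [gcomp]. *)
have compE b (eb : gid X R (gcod X R a) = b) (e' : gcod X R a = gdom X R b) :
    gcomp e' = a.
  by case: _ / eb e'; apply: comp_id_l.
apply: (bij_inj (@gq_iso _ _ N (Point a))).
by rewrite -(gq_cocycle e m) gq_psi_eq //; apply: compE.
Qed.

Definition gen_arrow : points (gmor X) := @Point K (Spec (hG H)) (hG H) (rings_id (hG H)).

(** The value of [gq_psi] lies in the fibre at (Gamma, [etaR]); quasi-coherence identifies that
    fibre with Gamma (x)_A N_(A,1). *)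
Definition gq_coaction_fun (m : M) : tens (etaR H) M :=
  sval (bij_inverse (oadj_bij N (p := pt_push (gcod X) gen_arrow) (frefl (etaR H))))
   (gq_psi N gen_arrow
     (otheta N (p := pt_push (gdom X) gen_arrow) (frefl (etaL H)) m)).

Lemma oadj_coaction m :
  oadj N (p := pt_push (gcod X) gen_arrow) (frefl (etaR H)) (gq_coaction_fun m) =
  gq_psi N gen_arrow (otheta N (p := pt_push (gdom X) gen_arrow) (frefl (etaL H)) m).
Proof. by rewrite /gq_coaction_fun; case: bij_inverse => g [? gK]; apply: gK. Qed.

Fact gq_coactionD : {morph gq_coaction_fun : m n / m + n}.
Proof.
move=> m n; apply: (bij_inj (oadj_bij N (p := pt_push (gcod X) gen_arrow) (frefl (etaR H)))).
by rewrite linearD !oadj_coaction !linearD.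
Qed.

Fact gq_coactionZ a m : gq_coaction_fun (a *: m) = etaL H a *: gq_coaction_fun m.
Proof.
apply: (bij_inj (oadj_bij N (p := pt_push (gcod X) gen_arrow) (frefl (etaR H)))).
by rewrite linearZ_LR !oadj_coaction !linearZ_LR.
Qed.

Definition gq_coaction : {linear M -> tens (etaR H) M | etaL H \; *:%R} :=
  mk_semilinear gq_coactionD gq_coactionZ.

(** Naturality of [gq_psi] along the map of points (Gamma, 1) -> (R, a) given by [a] itself. *)
Lemma oadj_base_change_coaction (R : sring K) (a : gmor X R)
    (x y : {rmorphism hA H -> R})
    (ex : x =1 (gdom X R a : {rmorphism hA H -> R}))
    (ey : y =1 (gcod X R a : {rmorphism hA H -> R})) m :
  oadj N (p := Point (gcod X R a)) ey
    (tens_map y (a : {rmorphism hG H -> R}) idfun (gq_coaction m)) =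
  gq_psi N (Point a) (otheta N (p := Point (gdom X R a)) ex m).
Proof.
pose f : hom gen_arrow (Point a : points (gmor X)) :=
  @PtHom K (Spec (hG H)) gen_arrow (Point a) a (rings_comp1r a).
have := theta_oadj (N := N) (pt_push_hom (gcod X) f) (frefl (etaR H)) ey
  (gq_coaction m).
rewrite oadj_coaction => /= <-.
rewrite -(theta_otheta (N := N) (pt_push_hom (gdom X) f) (frefl (etaL H)) ex).
exact: esym (qh_natural (gq_psi N) f _).
Qed.

(** This is [oadj_base_change_coaction] at the identity arrow of 1 : A -> A, which acts trivially by
    [gq_psi_id]. *)
Fact gq_counital (m : M) :
  tlift (fun a n => a *: n)
    (tens_map (rings_id (hA H)) (epsilon H) idfun (gq_coaction m)) = m.
Proof.
have X_gpd := gp_groupoid X.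
pose x0 : gob X (hA H) := rings_id (hA H); pose a := gid X (hA H) x0.
have ed : gdom X (hA H) a = x0 := dom_id X_gpd x0.
have ec : gcod X (hA H) a = x0 := cod_id X_gpd x0.
have e : gcod X (hA H) a = gdom X (hA H) a by rewrite ed ec.
have ex : rings_id (hA H) =1 (gdom X _ a : {rmorphism hA H -> hA H}) :=
  eq_rmorph (esym ed).
have ey : rings_id (hA H) =1 (gcod X _ a : {rmorphism hA H -> hA H}) :=
  eq_rmorph (esym ec).
have oadjE (u : tens (rings_id (hA H)) M) :
    oadj N (p := Point (gcod X (hA H) a)) ey u =
    otheta N (p := Point (gcod X (hA H) a)) ey (tlift (fun a n => a *: n) u).
  move: u; apply: tens_ext => [t u|t u|r n]; first exact: linearD.
  - by rewrite (tliftD (scale_balanced M)) linearD.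
  - by rewrite [LHS]oadj_pure (tlift_pure (scale_balanced M)) linearZ_LR.
have := oadj_base_change_coaction ex ey m; rewrite oadjE.
move=> /(congr1 (theta N (pt_same e))); rewrite gq_psi_id.
rewrite (theta_otheta (pt_same e) ey ex).
(* Transport to the point (A, 1), where [otheta] is the identity. *)
move=> /(congr1 (theta N (pt_same ed))).
rewrite !(theta_otheta (pt_same ed) ex (frefl _)).
by rewrite !otheta_origin.
Qed.

Fact gq_coassociative (m : M) :
  tens_assoc (tens_map (rinr (etaR H) (etaL H) \o etaR H) (Delta H) idfun
                (gq_coaction m)) =
  tens_map (N' := restr (etaL H) (tens (etaR H) M)) (etaR H)
    idfun gq_coaction (gq_coaction m).
Proof.
pose M' := restr (etaL H) (tens (etaR H) M).
pose i1 : gmor X (hG2 K_infinite H) := hG_inl K_infinite H.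
pose i2 : gmor X (hG2 K_infinite H) := hG_inr K_infinite H.
pose e : gcod X _ i1 = gdom X _ i2 := hG_composable K_infinite H.
pose r1 : {rmorphism hA H -> hG2 K_infinite H} := rings_comp i1 (etaL H).
pose r2 : {rmorphism hA H -> hG2 K_infinite H} := rings_comp i1 (etaR H).
pose r3 : {rmorphism hA H -> hG2 K_infinite H} := rings_comp i2 (etaR H).
pose i1r : {rmorphism hG H -> hG2 K_infinite H} := i1.
pose i2r : {rmorphism hG H -> hG2 K_infinite H} := i2.
have i1r2 : i1r \o etaR H =1 r2 by [].
have i2r3 : i2r \o etaR H =1 r3 by [].
pose G b (u : M') : tens r3 M :=
  i1r b *: tens_map r3 i2r idfun (u : tens (etaR H) M).
have Gbal : balanced (etaR H) G.
  split=> [u g g'|g u u'|g k u]; rewrite /G.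
  - by rewrite rmorphD scalerDl.
  - by rewrite (base_changeD i2r3) scalerDr.
  - rewrite restr_scaleE (base_changeZ i2r3) rmorphM -scalerA.
    by congr (_ *: (_ *: _)); apply: rinl_rinr.
(* [tlift G] is inverse to the associativity isomorphism, so coassociativity may
   be checked over Gamma (x)_A Gamma, where it is the cocycle condition for the
   universal composable pair, whose composite is Delta. *)
have assocK (Y : tens (etaR H) M') :
    tens_assoc (g := etaL H) (h := etaR H) (tlift G Y) = Y.
  move: Y; apply: tens_ext => [t u|//|b u].
    by rewrite (tliftD Gbal) tens_assocD.
  rewrite (tlift_pure Gbal) /G.
  move: u; apply: tens_ext => [t u|t u|c n].
  - by rewrite (base_changeD i2r3) scalerDr tens_assocD.
  - exact: (@tpureDr _ _ (etaR H) M').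
  rewrite (base_change_pure i2r3) tpureZ.
  have -> : i1r b * i2r c = rpure (etaR H) (etaL H) b c.
    by rewrite [LHS]rpureM mul1r mulr1.
  exact: tens_assoc_pure.
rewrite -[RHS]assocK; congr (tens_assoc _).
pose ec := cod_comp (gp_groupoid X) e; pose ed := dom_comp (gp_groupoid X) e.
have ex : r1 =1 (gdom X _ (gcomp e) : {rmorphism hA H -> hG2 K_infinite H}) :=
  eq_rmorph (esym ed).
have ey : r3 =1 (gcod X _ (gcomp e) : {rmorphism hA H -> hG2 K_infinite H}) :=
  eq_rmorph (esym ec).
apply: (bij_inj (oadj_bij N (p := Point (gcod X _ i2)) (frefl r3))).
(* The middle term is the action of the composite arrow; expressed by the coaction it is base change
   along [Delta], the left side. *)
transitivity (theta N (pt_same ec) (gq_psi N (Point (gcomp e)) 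
    (otheta N (p := Point (gdom X _ (gcomp e))) ex m))).
  rewrite -(oadj_base_change_coaction ex ey) (theta_oadj (pt_same ec) ey (frefl r3)).
  rewrite base_change_id; congr (oadj _ _ (tens_map _ _ _ _)).
  by apply/funext => g; rewrite [RHS]spec_comp_universal.
rewrite -(theta_otheta (pt_same (esym ed)) (frefl r1) ex).
(* The composite acts as [i1] followed by [i2]; expanding the two actions in turn yields the
   iterated coaction. *)
apply: etrans (gq_cocycle e _) _.
rewrite -(oadj_base_change_coaction (a := i1) (frefl r1) (frefl r2)).
have sq : idfun \o etaR H =1 etaR H \o idfun by [].
have cD : {morph (gq_coaction : M -> M') : m n / m + n} := linearD _.
have cZ k n : (gq_coaction : M -> M') (k *: n) = idfun k *: (gq_coaction n : M').
  exact: linearZ_LR.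
move: (gq_coaction m); apply: tens_ext => [t u|t u|g n].
- by rewrite (base_changeD i1r2) !linearD.
- by rewrite (tens_mapD sq cD cZ) (tliftD Gbal) linearD.
symmetry; rewrite (tens_map_pure sq cD cZ) (tlift_pure Gbal) /G.
rewrite (base_change_pure i1r2) linearZ_LR.
rewrite [oadj _ _ (tpure _ _ _)]oadj_pure !linearZ_LR; congr (_ *: _).
rewrite (theta_otheta (pt_same e) (frefl r2) (frefl (gdom X _ i2))).
exact: oadj_base_change_coaction.
Qed.

Definition gq_comodule : comodule H :=
  @Comodule K H M gq_coaction gq_coassociative gq_counital.

End Object.
End SheafToComodule.

(** * The equivalence *)

(** On pure tensors this is naturality of [tau] along the map of points from the origin to [p]. *)
Lemma oadj_natural (K : Type) (A : sring K) (N N' : qcoh (Spec A))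
    (tau : qcoh_hom N N') (p : points (Spec A)) (x : {rmorphism A -> pt_ring p})
    (e : x =1 (pt_elt p : {rmorphism A -> pt_ring p})) (t : tens x (Norigin N)) :
  tau p (oadj N e t) = oadj N' e (tens_map x idfun (tau (origin A)) t).
Proof.
move: t; apply: tens_ext => [t u|t u|r m]; first by rewrite !linearD.
  by rewrite extendD linearD.
rewrite [oadj N _ _]oadj_pure linearZ_LR /otheta qh_natural extend_pure.
by rewrite [RHS]oadj_pure.
Qed.

Section Equivalence.
Variables (K : Type) (K_infinite : infinite_set [set: K]) (H : hopf_algebroid K).

Notation X := (spec_groupoid H).
Notation comod := (gq_comodule K_infinite (H := H)).
Notation sheaf := (csheaf_gqcoh K_infinite (H := H)).

Section Morphism.
Variables (N N' : gqcoh X) (tau : gqcoh_hom N N').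

Definition gq_comodule_lin : {linear comod N -> comod N'} := tau (origin (hA H)).

Fact gq_comodule_commutes m :
  coaction (comod N') (gq_comodule_lin m) =
  tens_map (etaR H) idfun gq_comodule_lin (coaction (comod N) m).
Proof.
apply: (bij_inj (oadj_bij N' (p := pt_push (gcod X) (gen_arrow H)) (frefl (etaR H)))).
rewrite -[RHS](oadj_natural tau) !oadj_coaction.
rewrite [RHS](gqh_commutes tau) /otheta.
by congr (gq_psi N' _ _); rewrite -qh_natural.
Qed.

Definition gq_comodule_hom : comodule_hom (comod N) (comod N') :=
  ComoduleHom gq_comodule_commutes.

End Morphism.

Definition gq_comodule_functor : functor (quasi_coherent_sheaves X) (comodules H) :=
  @Functor (quasi_coherent_sheaves X) (comodules H) comod gq_comodule_hom
    (fun N => comodule_hom_ext (s := gq_comodule_hom (gqcoh_id N))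
      (t := comodule_id (comod N)) (frefl _))
    (fun N N' N'' t s => comodule_hom_ext (s := gq_comodule_hom (gqcoh_comp t s))
      (t := comodule_comp (gq_comodule_hom t) (gq_comodule_hom s)) (frefl _)).

(** The linear inverse [g] commutes with the coactions because 1 (x) g inverts 1 (x) h. *)
Lemma comodule_iso (M N : comodules H) (h : hom M N) :
  bijective (cm_lin h) -> is_iso h.
Proof.
move=> /bij_inverse [g [hK gK]].
have gD : {morph g : x y / x + y}.
  by move=> x y; apply: (can_inj hK); rewrite gK linearD !gK.
have gZ a x : g (a *: x) = a *: g x by apply: (can_inj hK); rewrite gK linearZ !gK.
pose g' : {linear N -> M} := mk_linear gD gZ.
have extK (x : {rmorphism hA H -> hG H}) (t : tens x N) :
  tens_map x idfun h (tens_map x idfun g' t) = t.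
  rewrite -extend_comp -[RHS]base_change_id; congr (tens_map _ _ _ _).
  by apply/funext => n; apply: gK.
have extK' (x : {rmorphism hA H -> hG H}) (t : tens x M) :
  tens_map x idfun g' (tens_map x idfun h t) = t.
  rewrite -extend_comp -[RHS]base_change_id; congr (tens_map _ _ _ _).
  by apply/funext => n; apply: hK.
have gP n : coaction M (g' n) = tens_map (etaR H) idfun g' (coaction N n).
  by rewrite -[n in RHS]gK cm_commutes extK'.
exists (ComoduleHom gP); split; apply: comodule_hom_ext => n; [exact: hK|exact: gK].
Qed.

(** Injectivity of each [h p] makes the fibrewise inverses linear, natural and compatible with the
    actions. *)
Lemma gqcoh_iso (M N : quasi_coherent_sheaves X) (h : hom M N) :
  (forall p, bijective (h p)) -> is_iso h.
Proof.
move=> hbij.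
pose g p : N p -> M p := sval (bij_inverse (hbij p)).
have hK p : cancel (h p) (g p) by rewrite /g; case: bij_inverse => ? [].
have gK p : cancel (g p) (h p) by rewrite /g; case: bij_inverse => ? [].
have gD p : {morph g p : x y / x + y}.
  by move=> x y; apply: (can_inj (hK p)); rewrite gK linearD !gK.
have gZ p a x : g p (a *: x) = a *: g p x.
  by apply: (can_inj (hK p)); rewrite gK linearZ !gK.
pose g' p : {linear N p -> M p} := mk_linear (gD p) (gZ p).
have gnat (p q : points (gob X)) (f : hom p q) (m : N p) :
    g' q (theta N f m) = theta M f (g' p m).
  by apply: (can_inj (hK q)); rewrite qh_natural [LHS]gK [h p _]gK.
pose g'' : qcoh_hom N M := QCohHom gnat.
have gcomm (R : sring K) (a : gmor X R) (m : N (Point (gdom X R a))) :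
    g'' (Point (gcod X R a)) (gq_psi N (Point a) m) =
    gq_psi M (Point a) (g'' (Point (gdom X R a)) m).
  apply: (can_inj (hK _)); rewrite [LHS]gK gqh_commutes.
  by rewrite -[m in LHS]gK.
exists (GQCohHom gcomm); split; apply: gqcoh_hom_ext => p n; [exact: hK|exact: gK].
Qed.

Section Unit.
Variable M : comodule H.

Notation FM := (sheaf M).
Notation GFM := (comod FM).

(** The fibre at (A, 1) of the sheaf of M is A (x)_A M; this map inverts the multiplication A (x)_A
    M -> M. *)
Definition unit_fun (m : M) : GFM := tpure (rings_id (hA H)) 1 m.

Fact unit_funD : {morph unit_fun : m n / m + n}.
Proof. exact: tpureDr. Qed.

Fact unit_funZ a m : unit_fun (a *: m) = a *: unit_fun m.
Proof.
by rewrite /unit_fun -(tpure_bal (rings_id (hA H))) mul1r [RHS]tpureZ mulr1.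
Qed.

Definition unit_linear : {linear M -> GFM} := mk_linear unit_funD unit_funZ.

Lemma unit_bij : bijective unit_linear.
Proof.
exists (tlift (fun a (n : M) => a *: n)) => [m|].
  by rewrite [LHS](tlift_pure (scale_balanced M)) scale1r.
apply: tens_ext => [t u|//|a m].
  by rewrite (tliftD (scale_balanced M)) linearD.
by rewrite (tlift_pure (scale_balanced M)) linearZ_LR [LHS]tpureZ mulr1.
Qed.

Lemma otheta_unit (p : points (Spec (hA H))) (x : {rmorphism hA H -> pt_ring p})
    (e : x =1 (pt_elt p : {rmorphism hA H -> pt_ring p})) m :
  otheta FM e (unit_linear m) = tpure (pt_elt p : {rmorphism hA H -> pt_ring p}) 1 m.
Proof.
rewrite [LHS](base_change_pure (f := x) (M := M) (spec_pt_hom (origin_hom e))).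
by rewrite rmorph1.
Qed.

Fact unit_commutes m :
  coaction GFM (unit_linear m) = tens_map (etaR H) idfun unit_linear (coaction M m).
Proof.
apply: (bij_inj (oadj_bij FM (p := pt_push (gcod X) (gen_arrow H)) (frefl (etaR H)))).
rewrite oadj_coaction otheta_unit [LHS]cpsi_pure scale1r.
(* The target fibre is formed with the composite of 1 and [etaR]; base change along the identity
   compares it with the one formed with [etaR]. *)
set y : {rmorphism hA H -> hG H} := rings_comp (rings_id (hG H)) (etaR H).
have yE : idfun \o etaR H =1 y by [].
move: (coaction M m); apply: tens_ext => [t u|t u|g n].
- exact: (base_changeD yE).
- by rewrite extendD linearD.
- rewrite (base_change_pure yE) extend_pure [RHS]oadj_pure otheta_unit.
  by rewrite [RHS]tpureZ mulr1.
Qed.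

Definition unit_hom : comodule_hom M GFM := ComoduleHom unit_commutes.

End Unit.

Fact unit_natural (M N : comodules H) (h : hom M N) :
  compc (unit_hom N : @hom (comodules H) _ _) h =
  compc (gq_comodule_hom (csheaf_gqcoh_hom K_infinite h) :
    @hom (comodules H) _ _) (unit_hom M).
Proof. by apply: comodule_hom_ext => m; apply/esym/extend_pure. Qed.

Section Counit.
Variable N : gqcoh X.

Notation GN := (comod N).
Notation FGN := (sheaf GN).

Definition counit_map (p : points (Spec (hA H))) : {linear FGN p -> N p} :=
  oadj N (frefl (pt_elt p : {rmorphism hA H -> pt_ring p})).

Fact counit_map_natural (p q : points (Spec (hA H))) (f : hom p q) (m : FGN p) :
  counit_map q (theta FGN f m) = theta N f (counit_map p m).
Proof. exact/esym/theta_oadj. Qed.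

Definition counit_qcoh : qcoh_hom FGN N := QCohHom counit_map_natural.

(** By linearity it suffices to treat 1 (x) m, where [oadj_base_change_coaction] says that the
    action rebuilt from the coaction is the given one. *)
Fact counit_commutes (R : sring K) (a : gmor X R) (m : FGN (Point (gdom X R a))) :
  counit_qcoh (Point (gcod X R a)) (gq_psi FGN (Point a) m) =
  gq_psi N (Point a) (counit_qcoh (Point (gdom X R a)) m).
Proof.
move: m; apply: tens_ext => [t u|t u|r m]; try by rewrite !linearD.
rewrite [gq_psi FGN _ _]cpsi_pure [counit_qcoh _ (tpure _ _ _)]oadj_pure !linearZ_LR.
by congr (_ *: _); apply: oadj_base_change_coaction.
Qed.

Definition counit_hom : gqcoh_hom FGN N := GQCohHom counit_commutes.

End Counit.

Fact counit_natural (M N : quasi_coherent_sheaves X) (h : hom M N) :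
  compc (counit_hom N : @hom (quasi_coherent_sheaves X) _ _)
     (csheaf_gqcoh_hom K_infinite (gq_comodule_hom h)) =
  compc h (counit_hom M : @hom (quasi_coherent_sheaves X) _ _).
Proof. by apply: gqcoh_hom_ext => p m; apply/esym/oadj_natural. Qed.

End Equivalence.

Theorem theorem1 (K : Type) (K_infinite : infinite_set [set: K])
    (H : hopf_algebroid K) :
  equivalent_categories (comodules H)
    (quasi_coherent_sheaves (spec_groupoid H)).
Proof.
exists (csheaf_functor K_infinite H), (gq_comodule_functor K_infinite H); split.
- exists (@NatTrans (comodules H) (comodules H) (idF _)
    (compF (gq_comodule_functor K_infinite H) (csheaf_functor K_infinite H))
    (unit_hom K_infinite (H := H)) (@unit_natural K K_infinite H)) => M.
  exact/comodule_iso/unit_bij.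
- exists (@NatTrans (quasi_coherent_sheaves (spec_groupoid H)) _
    (compF (csheaf_functor K_infinite H) (gq_comodule_functor K_infinite H)) (idF _)
    (counit_hom K_infinite (H := H)) (@counit_natural K K_infinite H)) => N.
  by apply: gqcoh_iso => p; apply: oadj_bij.
Qed.
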